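(* Setting: integers $N,Q,S\ge1$, $1\le M\le N$, $J\ge1$; $\mathbf{H}\in\mathbb{R}^{Q\times N}\setminus\{\mathbf{0}\}$, $\mathbf{y}\in\mathbb{R}^Q$, a real matrix $\mathbf{V}_0$ with $N$ columns, and for $s\in\{1,\dots,S\}$: $P_s\ge1$, $\mathbf{V}_s\in\mathbb{R}^{P_s\times N}$, $\mathbf{c}_s\in\mathbb{R}^{P_s}$; $\Phi:\mathbb{R}^Q\to\mathbb{R}$; functions $\psi_{s,\delta}:\mathbb{R}\to\mathbb{R}$ for $\delta>0$; $F_\delta(\mathbf{x})=\Phi(\mathbf{H}\mathbf{x}-\mathbf{y})+\sum_{s=1}^S\psi_{s,\delta}(\|\mathbf{V}_s\mathbf{x}-\mathbf{c}_s\|)+\|\mathbf{V}_0\mathbf{x}\|^2$. Assume: (A1i) $\Phi$ is continuous and coercive; (A1ii) for every $\delta>0$ and $s$, $\psi_{s,\delta}$ is continuous and nonnegative; (A1iii) $\operatorname{Ker}\mathbf{H}\cap\operatorname{Ker}\mathbf{V}_0=\{\mathbf{0}\}$. Fix $\delta>0$ and assume: (A3i) $\Phi$ is differentiable with $L$-Lipschitz gradient; (A3ii) each $\psi_{s,\delta}$ is differentiable; (A3iii) each $t\mapsto\psi_{s,\delta}(\sqrt t)$ is concave on $[0,+\infty)$; (A3iv) for each $s$ there is $\overline\omega_s\in[0,+\infty)$ with $0\le\dot\psi_{s,\delta}(t)\le\overline\omega_s t$ for all $t>0$, and $\lim_{t\to0}\dot\psi_{s,\delta}(t)/t\in\mathbb{R}$.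 Assume moreover that $F_\delta$ satisfies the Kurdyka–Łojasiewicz inequality. Let $\omega_{s,\delta}(t)=\dot\psi_{s,\delta}(t)/t$, extended by continuity at $0$, fix $\mu\in[L,+\infty)$ and set $\mathbf{A}(\mathbf{x})=\mu\mathbf{H}^\top\mathbf{H}+2\mathbf{V}_0^\top\mathbf{V}_0+\mathbf{V}^\top\operatorname{Diag}\{\mathbf{b}(\mathbf{x})\}\mathbf{V}$, where $\mathbf{V}=[\mathbf{V}_1^\top|\cdots|\mathbf{V}_S^\top]^\top$ and $b_{P_1+\dots+P_{s-1}+p}(\mathbf{x})=\omega_{s,\delta}(\|\mathbf{V}_s\mathbf{x}-\mathbf{c}_s\|)$ for $p\in\{1,\dots,P_s\}$. Consider the MM subspace iteration: $\mathbf{x}_0\in\mathbb{R}^N$; for each $k\in\mathbb{N}$, given a matrix $\mathbf{D}_k\in\mathbb{R}^{N\times M}$, set $\mathbf{u}_k^0=\mathbf{0}$ and for $j=1,\dots,J$: $\mathbf{B}_k^{j-1}=\mathbf{D}_k^\top\mathbf{A}(\mathbf{x}_k+\mathbf{D}_k\mathbf{u}_k^{j-1})\mathbf{D}_k$, $\mathbf{u}_k^j=\mathbf{u}_k^{j-1}-(\mathbf{B}_k^{j-1})^{\dagger}\mathbf{D}_k^\top\nabla F_\delta(\mathbf{x}_k+\mathbf{D}_k\mathbf{u}_k^{j-1})$ (pseudo-inverse $\dagger$); then $\mathbf{x}_{k+1}=\mathbf{x}_k+\mathbf{D}_k\mathbf{u}_k^J$. Let $\mathbf{g}_k=\nabla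 F_\delta(\mathbf{x}_k)$ and assume (A4) there exist $\gamma_0>0,\gamma_1>0$ such that for every $k$ the first column $\mathbf{d}_k^1$ of $\mathbf{D}_k$ satisfies $\mathbf{g}_k^\top\mathbf{d}_k^1\le-\gamma_0\|\mathbf{g}_k\|^2$ and $\|\mathbf{d}_k^1\|\le\gamma_1\|\mathbf{g}_k\|$. Claim: the sequence $(\mathbf{x}_k)_{k\in\mathbb{N}}$ converges to a critical point $\tilde{\mathbf{x}}$ of $F_\delta$ (i.e. $\nabla F_\delta(\tilde{\mathbf{x}})=\mathbf{0}$), and it has finite length: $\sum_{k=0}^{+\infty}\|\mathbf{x}_{k+1}-\mathbf{x}_k\|<+\infty$.
   Context: $\|\cdot\|$ is the Euclidean norm; $\dot\psi_{s,\delta}$ is the derivative of $\psi_{s,\delta}$. A differentiable function $G:\mathbb{R}^N\to\mathbb{R}$ satisfies the Kurdyka–Łojasiewicz inequality if for every $\tilde{\mathbf{x}}\in\mathbb{R}^N$ and every bounded neighborhood $E$ of $\tilde{\mathbf{x}}$ there exist constants $\kappa>0$, $\zeta>0$ and $\theta\in[0,1)$ such that $\|\nabla G(\mathbf{x})\|\ge\kappa|G(\mathbf{x})-G(\tilde{\mathbf{x}})|^\theta$ for every $\mathbf{x}\in E$ with $|G(\mathbf{x})-G(\tilde{\mathbf{x}})|<\zeta$. *)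

(* Defs.v *)
From HB Require Import structures.
From mathcomp Require Import all_boot all_order all_algebra.
From mathcomp Require Import all_classical all_reals all_analysis.
Set Implicit Arguments. Unset Strict Implicit. Unset Printing Implicit Defensive.
Import Order.TTheory GRing.Theory Num.Theory.
Import numFieldNormedType.Exports.
Local Open Scope classical_set_scope.
Local Open Scope ring_scope.

Section Defs.
Variable R : realType.

Definition dotv (n : nat) (u v : 'cV[R]_n) : R := \sum_(i < n) u i 0 * v i 0.
Definition enorm (n : nat) (v : 'cV[R]_n) : R := Num.sqrt (dotv v v).

Definition gradient_at (n : nat) (f : 'cV[R]_n -> R) (x g : 'cV[R]_n) : Prop :=
  differentiable f x /\ forall h : 'cV[R]_n, 'd f x h = dotv g h.

(* the gradient (uniquely determined when f is differentiable at x) *)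
Definition grad (n : nat) (f : 'cV[R]_n -> R) (x : 'cV[R]_n) : 'cV[R]_n :=
  xget 0 [set g | gradient_at f x g].

Definition is_pinv (m n : nat) (A : 'M[R]_(m, n)) (X : 'M[R]_(n, m)) : Prop :=
  [/\ A *m X *m A = A, X *m A *m X = X,
      (A *m X)^T = A *m X & (X *m A)^T = X *m A].
Definition pinv (m n : nat) (A : 'M[R]_(m, n)) : 'M[R]_(n, m) :=
  xget 0 [set X | is_pinv A X].

Definition coercive (n : nat) (f : 'cV[R]_n -> R) : Prop :=
  forall A : R, exists r : R, forall z, r <= enorm z -> A <= f z.

Definition concave_on_nonneg (f : R -> R) : Prop :=
  forall a b l : R, 0 <= a -> 0 <= b -> 0 <= l <= 1 ->
    l * f a + (1 - l) * f b <= f (l * a + (1 - l) * b).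

Definition omega (psi : R -> R) (t : R) : R :=
  if t == 0 then lim ((fun u => derive1 psi u / u) @ 0^'+) else derive1 psi t / t.

Definition Fdelta (N Q S P0 : nat) (P : 'I_S -> nat)
  (H : 'M[R]_(Q, N)) (y : 'cV[R]_Q) (V0 : 'M[R]_(P0, N))
  (V : forall s : 'I_S, 'M[R]_(P s, N)) (c : forall s : 'I_S, 'cV[R]_(P s))
  (Phi : 'cV[R]_Q -> R) (psid : 'I_S -> R -> R) (x : 'cV[R]_N) : R :=
  Phi (H *m x - y) + \sum_(s < S) psid s (enorm (V s *m x - c s))
  + enorm (V0 *m x) ^+ 2.

(* A(x) = mu H^T H + 2 V0^T V0 + V^T Diag(b(x)) V, with V^T Diag(b) V written
   blockwise as sum_s omega_s(||V_s x - c_s||) V_s^T V_s *)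
Definition Amat (N Q S P0 : nat) (P : 'I_S -> nat) (mu : R)
  (H : 'M[R]_(Q, N)) (V0 : 'M[R]_(P0, N))
  (V : forall s : 'I_S, 'M[R]_(P s, N)) (c : forall s : 'I_S, 'cV[R]_(P s))
  (psid : 'I_S -> R -> R) (x : 'cV[R]_N) : 'M[R]_N :=
  mu *: (H^T *m H) + 2%:R *: (V0^T *m V0)
  + \sum_(s < S) (omega (psid s) (enorm (V s *m x - c s)) *: ((V s)^T *m V s)).

Definition mm_inner (N M : nat) (A : 'cV[R]_N -> 'M[R]_N)
  (gF : 'cV[R]_N -> 'cV[R]_N) (xk : 'cV[R]_N) (Dk : 'M[R]_(N, M)) (j : nat)
  : 'cV[R]_M :=
  iter j (fun u =>
    let z := xk + Dk *m u in
    u - pinv (Dk^T *m A z *m Dk) *m (Dk^T *m gF z)) 0.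

Definition mm_step (N M J : nat) (A : 'cV[R]_N -> 'M[R]_N)
  (gF : 'cV[R]_N -> 'cV[R]_N) (xk : 'cV[R]_N) (Dk : 'M[R]_(N, M)) : 'cV[R]_N :=
  xk + Dk *m mm_inner A gF xk Dk J.

Definition KL_ineq (n : nat) (G : 'cV[R]_n -> R) : Prop :=
  forall (xt : 'cV[R]_n) (E : set 'cV[R]_n),
    (exists e : R, 0 < e /\ forall x, enorm (x - xt) < e -> E x) ->
    (exists r : R, forall x, E x -> enorm x <= r) ->
    exists kappa zeta theta : R, [/\ 0 < kappa, 0 < zeta, 0 <= theta < 1 &
      forall x, E x -> `|G x - G xt| < zeta ->
        kappa * (`|G x - G xt| `^ theta) <= enorm (grad G x)].

End Defs.

(* Main.v *)
(* Each inner iteration minimises a quadratic majorant of F over the range of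
   D_k, so it decreases F by at least (nu/2) times the squared displacement,
   where nu > 0 is a lower bound of A given by (A1iii). Comparing the first inner
   iteration with a well-chosen step along the first column of D_k yields, by
   (A4), a decrease of at least b |g_k|^2. Hence F(x_k) - F(x_{k+1}) dominates
   |x_{k+1} - x_k| |g_k| up to a constant, and (x_k) is bounded because F is
   coercive. Applied at a cluster point xt, on a ball containing all iterates, the
   Kurdyka-Lojasiewicz inequality makes |x_{k+1} - x_k| bounded by the decrease of
   (F(x_k) - F(xt))^(1 - theta), up to a constant; this telescopes to the finite
   length, so the whole sequence converges to xt. Finally grad F (xt) = 0 follows by
   passing to the limit in F(x_k + h) <= F(x_k) + <g_k, h> + eta |h|^2, so that
   continuity of grad F is not required. *)
Require Import Defs.
From HB Require Import structures.
From mathcomp Require Import all_boot all_order all_algebra.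
From mathcomp Require Import all_classical all_reals all_analysis.
From mathcomp Require Import ring lra.
Import Order.TTheory GRing.Theory Num.Theory.
Import numFieldNormedType.Exports.
Local Open Scope classical_set_scope.
Local Open Scope ring_scope.

(** * Euclidean inner product and norm on column vectors, with crude operator bounds *)

Section InnerProduct.
Context {R : realType}.
Implicit Types n m : nat.

Lemma dotvE n (u v : 'cV[R]_n) : dotv u v = (u^T *m v) 0 0.
Proof. by rewrite !mxE; apply: eq_bigr => i _; rewrite mxE. Qed.

Lemma dotvC n (u v : 'cV[R]_n) : dotv u v = dotv v u.
Proof. by apply: eq_bigr => i _; rewrite mulrC. Qed.

Lemma dotvDr n (u v w : 'cV[R]_n) : dotv u (v + w) = dotv u v + dotv u w.
Proof. by rewrite !dotvE mulmxDr mxE. Qed.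

Lemma dotvZr n a (u v : 'cV[R]_n) : dotv u (a *: v) = a * dotv u v.
Proof. by rewrite !dotvE -scalemxAr mxE. Qed.

Lemma dotvNr n (u v : 'cV[R]_n) : dotv u (- v) = - dotv u v.
Proof. by rewrite !dotvE mulmxN mxE. Qed.

Lemma dotvDl n (u v w : 'cV[R]_n) : dotv (v + w) u = dotv v u + dotv w u.
Proof. by rewrite !(dotvC _ _ u) dotvDr. Qed.

Lemma dotvZl n a (u v : 'cV[R]_n) : dotv (a *: v) u = a * dotv v u.
Proof. by rewrite !(dotvC _ _ u) dotvZr. Qed.

Lemma dotvNl n (u v : 'cV[R]_n) : dotv (- v) u = - dotv v u.
Proof. by rewrite !(dotvC _ _ u) dotvNr. Qed.

Lemma dotv0l n (u : 'cV[R]_n) : dotv 0 u = 0.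
Proof. by rewrite dotvE trmx0 mul0mx mxE. Qed.

Lemma dotv0r n (u : 'cV[R]_n) : dotv u 0 = 0.
Proof. by rewrite dotvC dotv0l. Qed.

Lemma dotv_suml n (I : finType) (f : I -> 'cV[R]_n) (v : 'cV[R]_n) :
  dotv (\sum_i f i) v = \sum_i dotv (f i) v.
Proof.
elim/big_rec2: _ => [|i a b _ <-]; first by rewrite dotv0l.
by rewrite dotvDl.
Qed.

Lemma dotv_sumr n (I : finType) (f : I -> 'cV[R]_n) (v : 'cV[R]_n) :
  dotv v (\sum_i f i) = \sum_i dotv v (f i).
Proof. by rewrite dotvC dotv_suml; apply: eq_bigr => i _; rewrite dotvC. Qed.

Lemma dotv_mulmxl m n (A : 'M[R]_(m, n)) u v :
  dotv (A *m u) v = dotv u (A^T *m v).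
Proof. by rewrite !dotvE trmx_mul mulmxA. Qed.

Lemma dotv_mulmxr m n (A : 'M[R]_(m, n)) u v :
  dotv u (A *m v) = dotv (A^T *m u) v.
Proof. by rewrite dotv_mulmxl trmxK. Qed.

Lemma dotvv_ge0 n (u : 'cV[R]_n) : 0 <= dotv u u.
Proof. by apply: sumr_ge0 => i _; rewrite -expr2 sqr_ge0. Qed.

Lemma dotvv_eq0 n (u : 'cV[R]_n) : dotv u u = 0 -> u = 0.
Proof.
move=> /eqP; rewrite psumr_eq0 => [|i _]; last by rewrite -expr2 sqr_ge0.
move=> /allP u0; apply/colP => i; rewrite mxE; apply/eqP.
by have := u0 i (mem_index_enum i); rewrite -expr2 sqrf_eq0.
Qed.

Lemma dotv_inj n (u v : 'cV[R]_n) : (forall h, dotv u h = dotv v h) -> u = v.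
Proof.
move=> uv; apply/eqP; rewrite -subr_eq0; apply/eqP/dotvv_eq0.
by rewrite dotvDl dotvNl uv subrr.
Qed.

Lemma enorm_ge0 n (u : 'cV[R]_n) : 0 <= enorm u.
Proof. exact: sqrtr_ge0. Qed.

Lemma enorm_sqr n (u : 'cV[R]_n) : enorm u ^+ 2 = dotv u u.
Proof. by rewrite sqr_sqrtr // dotvv_ge0. Qed.

Lemma enorm0 n : enorm (0 : 'cV[R]_n) = 0.
Proof. by rewrite /enorm dotv0l sqrtr0. Qed.

Lemma enorm_eq0 n (u : 'cV[R]_n) : enorm u = 0 -> u = 0.
Proof. by move=> u0; apply: dotvv_eq0; rewrite -enorm_sqr u0 expr0n. Qed.

Lemma enormZ n a (u : 'cV[R]_n) : enorm (a *: u) = `|a| * enorm u.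
Proof.
by rewrite /enorm dotvZl dotvZr mulrA -expr2 sqrtrM ?sqr_ge0 // sqrtr_sqr.
Qed.

Lemma enormN n (u : 'cV[R]_n) : enorm (- u) = enorm u.
Proof. by rewrite -scaleN1r enormZ normrN1 mul1r. Qed.

Lemma enormBC n (u v : 'cV[R]_n) : enorm (u - v) = enorm (v - u).
Proof. by rewrite -enormN opprB. Qed.

(** Cauchy-Schwarz: the squared norm of [dotv u v *: u - enorm u ^+ 2 *: v] is nonnegative and
    equals |u|^2 (|u|^2 |v|^2 - <u,v>^2). *)
Lemma dotv_le n (u v : 'cV[R]_n) : dotv u v <= enorm u * enorm v.
Proof.
have [u0|u0] := eqVneq (enorm u) 0.
  by rewrite u0 mul0r (enorm_eq0 _ _ u0) dotv0l.
have u_gt0 : 0 < enorm u by rewrite lt_def u0 enorm_ge0.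
have := dotvv_ge0 _ (dotv u v *: u - enorm u ^+ 2 *: v).
rewrite dotvDl !dotvDr !dotvNl !dotvNr !dotvZl !dotvZr (dotvC _ v u).
rewrite -!enorm_sqr.
set a := enorm u in u_gt0 *; set b := enorm v; set c := dotv u v => h.
have h2 : c ^+ 2 <= (a * b) ^+ 2.
  have : 0 <= a ^+ 2 * ((a * b) ^+ 2 - c ^+ 2) by apply: (le_trans h); lra.
  by rewrite pmulr_rge0 ?exprn_gt0 // subr_ge0.
apply: le_trans (ler_norm c) _.
by rewrite -(@ler_pXn2r _ 2) ?nnegrE ?mulr_ge0 ?enorm_ge0 // -normrX ger0_norm
  ?sqr_ge0.
Qed.

Lemma dotv_norm_le n (u v : 'cV[R]_n) : `|dotv u v| <= enorm u * enorm v.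
Proof.
by rewrite ler_norml dotv_le lerNl -dotvNl -(enormN _ u) dotv_le.
Qed.

Lemma enorm_sqrD n (u v : 'cV[R]_n) :
  enorm (u + v) ^+ 2 = enorm u ^+ 2 + 2 * dotv u v + enorm v ^+ 2.
Proof.
by rewrite !enorm_sqr dotvDl !dotvDr (dotvC _ v u) -!addrA; congr (_ + _); lra.
Qed.

Lemma enormD n (u v : 'cV[R]_n) : enorm (u + v) <= enorm u + enorm v.
Proof.
rewrite -(@ler_pXn2r _ 2) ?nnegrE ?addr_ge0 ?enorm_ge0 // enorm_sqrD.
have := dotv_le _ u v; lra.
Qed.

Lemma enormB n (u v : 'cV[R]_n) : enorm (u - v) <= enorm u + enorm v.
Proof. by rewrite -(enormN _ v) enormD. Qed.

Lemma coord_enorm n (u : 'cV[R]_n) i : `|u i 0| <= enorm u.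
Proof.
rewrite -sqrtr_sqr ler_sqrt ?dotvv_ge0 // /dotv (bigD1 i) //= -expr2.
by rewrite lerDl sumr_ge0 // => j _; rewrite -expr2 sqr_ge0.
Qed.

(** The crude factor n + 1, in place of sqrt n, avoids a root and stays positive for n = 0. *)
Lemma enorm_sup n (u : 'cV[R]_n) e : 0 <= e ->
  (forall i, `|u i 0| <= e) -> enorm u <= (n%:R + 1) * e.
Proof.
move=> e0 ue; rewrite -(@ler_pXn2r _ 2) ?nnegrE ?enorm_ge0 //; last first.
  by rewrite mulr_ge0 // addr_ge0.
rewrite enorm_sqr; apply: (@le_trans _ _ (\sum_(i < n) e ^+ 2)).
  apply: ler_sum => i _; rewrite -expr2 -(ger0_norm (sqr_ge0 (u i 0))) normrX.
  by rewrite ler_pXn2r ?nnegrE.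
rewrite sumr_const card_ord -[leLHS]mulr_natl exprMn ler_wpM2r ?sqr_ge0 //.
have : (0 : R) <= n%:R by []. nra.
Qed.

(** Cauchy-Schwarz on each row. The constant is kept strictly positive so that later proofs can
    divide by it. *)
Lemma mulmx_enorm m n (A : 'M[R]_(m, n)) :
  exists2 C : R, 0 < C & forall u, enorm (A *m u) <= C * enorm u.
Proof.
pose K := \sum_i enorm (row i A)^T.
have K0 : 0 <= K by apply: sumr_ge0 => i _; exact: enorm_ge0.
have m0 : (0 : R) <= m%:R by [].
exists ((m%:R + 1) * (K + 1)); first by rewrite mulr_gt0 // ltr_wpDl.
move=> u; rewrite -mulrA; apply: enorm_sup.
  by rewrite mulr_ge0 ?enorm_ge0 // addr_ge0.
move=> i; have -> : (A *m u) i 0 = dotv (row i A)^T u.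
  by rewrite mxE; apply: eq_bigr => j _; rewrite !mxE.
apply: le_trans (dotv_norm_le _ _ _) _; rewrite ler_wpM2r ?enorm_ge0 //.
rewrite /K (bigD1 i) //= -addrA lerDl addr_ge0 // sumr_ge0 // => j _.
exact: enorm_ge0.
Qed.

End InnerProduct.
Arguments dotvC {R n}. Arguments dotv_le {R n}. Arguments dotv_norm_le {R n}.
Arguments enormD {R n}. Arguments enormB {R n}. Arguments enormN {R n}.
Arguments enormBC {R n}.
Arguments enorm_ge0 {R n}. Arguments enorm_eq0 {R n}. Arguments dotvv_eq0 {R n}.
Arguments dotvv_ge0 {R n}. Arguments enorm_sqr {R n}.
Arguments enorm_sqrD {R n}.

(** * Existence of the Moore-Penrose inverse and solvability of the subspace normal equations *)

Section PseudoInverse.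
Context {R : realType}.

(** A row v of the left kernel of C^T C satisfies |C v^T|^2 = v C^T C v^T = 0, so v = 0 by
    injectivity. *)
Lemma mulmx_trmxl_unit m n (C : 'M[R]_(m, n)) :
  (forall u : 'cV[R]_n, C *m u = 0 -> u = 0) -> C^T *m C \in unitmx.
Proof.
move=> injC; rewrite -row_free_unit -kermx_eq0; apply/eqP/row_matrixP => i.
rewrite row0; set v := row i _.
have v0 : v *m (C^T *m C) = 0.
  by apply/sub_kermxP; rewrite row_sub.
have : C *m v^T = 0.
  apply: dotvv_eq0; rewrite dotv_mulmxl mulmxA dotvE trmxK.
  by rewrite mulmxA v0 mul0mx mxE.
by move=> /injC /(congr1 trmx); rewrite trmxK trmx0.
Qed.

(** The classical formula for a full-rank factorisation A = C E. The products A X = C (C^T C)^-1 C^T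
    and X A = E^T (E E^T)^-1 E are symmetric projectors, which yields the four Penrose
    identities. *)
Lemma is_pinv_rank_factor m r n (C : 'M[R]_(m, r)) (E : 'M[R]_(r, n)) :
  C^T *m C \in unitmx -> E *m E^T \in unitmx ->
  is_pinv (C *m E) (E^T *m invmx (E *m E^T) *m invmx (C^T *m C) *m C^T).
Proof.
move=> UC UE; set KC := invmx (C^T *m C); set KE := invmx (E *m E^T).
have symKC : KC^T = KC by rewrite trmx_inv trmx_mul trmxK.
have symKE : KE^T = KE by rewrite trmx_inv trmx_mul trmxK.
set X := E^T *m KE *m KC *m C^T.
have AX : C *m E *m X = C *m KC *m C^T.
  by rewrite /X !mulmxA -(mulmxA C E) -(mulmxA C) mulmxV // mulmx1.
have XA : X *m (C *m E) = E^T *m KE *m E.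
  rewrite /X !mulmxA -(mulmxA (_ *m KC)) -(mulmxA (_ *m KE)).
  by rewrite mulVmx // mulmx1.
split.
- by rewrite AX !mulmxA -(mulmxA (C *m KC)) -(mulmxA C) mulVmx // mulmx1.
- rewrite XA /X !mulmxA -(mulmxA (_ *m KE) E) -(mulmxA (_ *m KE) _ KE).
  by rewrite mulmxV // mulmx1.
- by rewrite AX !trmx_mul trmxK symKC mulmxA.
- by rewrite XA !trmx_mul trmxK symKE mulmxA.
Qed.

(* Unqualified, pinv is the partial inverse of mathcomp.classical.functions. *)
Lemma is_pinv_pinv m n (A : 'M[R]_(m, n)) : is_pinv A (Defs.pinv A).
Proof.
rewrite /Defs.pinv; case: xgetP => [X ->//|noX]; exfalso.
(* The factorisation of A as [col_base A *m row_base A] has full-rank factors, so both Gram matrices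
   are invertible and a pseudo-inverse exists. *)
have UC : (col_base A)^T *m col_base A \in unitmx.
  apply: mulmx_trmxl_unit => u /(congr1 trmx).
  rewrite trmx_mul trmx0 => uC; apply: trmx_inj; rewrite trmx0.
  have fC : row_free (col_base A)^T.
    by rewrite /row_free mxrank_tr; exact: col_base_full.
  by apply: (row_free_inj fC); rewrite uC mul0mx.
have UE : row_base A *m (row_base A)^T \in unitmx.
  rewrite -{1}(trmxK (row_base A)); apply: mulmx_trmxl_unit.
  move=> u /(congr1 trmx); rewrite trmx_mul trmx0 trmxK => uE.
  apply: trmx_inj; rewrite trmx0.
  by apply: (row_free_inj (row_base_free A)); rewrite uE mul0mx.
by have := is_pinv_rank_factor _ _ _ _ _ UC UE; rewrite mulmx_base => /noX.
Qed.

(* D^T g is orthogonal to Ker(D^T A D) = Ker D, hence in the range of D^T A D. *)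
Lemma mulmx_pinv_range N M (A : 'M[R]_N) (D : 'M[R]_(N, M)) (g : 'cV[R]_N) :
  A^T = A -> (forall v : 'cV[R]_N, dotv v (A *m v) = 0 -> v = 0) ->
  let B := D^T *m A *m D in B *m (Defs.pinv B *m (D^T *m g)) = D^T *m g.
Proof.
move=> symA posA B; have [BXB _ symBX _] := is_pinv_pinv _ _ B.
set X := Defs.pinv B in BXB symBX *; set b := D^T *m g.
have symB : B^T = B by rewrite /B !trmx_mul trmxK symA mulmxA.
pose w := b - B *m (X *m b).
have Bw : B *m w = 0.
  have BBX : B *m (B *m X) = B.
    by rewrite -{1}symB -{1}symBX -trmx_mul BXB symB.
  by rewrite mulmxBr (mulmxA B X) (mulmxA B (B *m X)) BBX subrr.
have Dw : D *m w = 0.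
  apply: posA; rewrite dotv_mulmxl.
  have -> : D^T *m (A *m (D *m w)) = B *m w by rewrite /B !mulmxA.
  by rewrite Bw dotv0r.
(* In <w,w>, the part [D^T *m g] of the left factor vanishes because [D *m w = 0], and the part in
   the range of B because B is symmetric with [B *m w = 0]. *)
have w0 : w = 0.
  apply: dotvv_eq0; rewrite {1}/w dotvDl dotvNl (dotv_mulmxl _ _ B) symB Bw.
  rewrite dotv0r.
  by rewrite subr0 dotv_mulmxl trmxK Dw dotv0r.
by apply/esym/eqP; rewrite -subr_eq0; apply/eqP.
Qed.

End PseudoInverse.

(** * Gradients in Euclidean terms and the descent lemma *)

Section Gradient.
Context {R : realType}.

Lemma norm_enorm n (h : 'cV[R]_n) : `|h| <= enorm h.
Proof.
change (mx_norm h <= enorm h).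
have [->|/mx_norm_neq0 [[i j] /= ->]] := eqVneq (mx_norm h) 0.
  exact: enorm_ge0.
by rewrite (ord1 j) coord_enorm.
Qed.

Lemma enorm_norm n (h : 'cV[R]_n) : enorm h <= (n%:R + 1) * `|h|.
Proof.
apply: enorm_sup => // i; rewrite [leRHS]mx_normrE.
exact: (le_bigmax _ (fun ij => `|h ij.1 ij.2|) (i, 0)).
Qed.

(** The ambient topology is that of the sup norm on matrices; the two norm comparisons above
    transfer it to Euclidean balls. *)
Lemma nbhs_enormP n (x : 'cV[R]_n) (P : set 'cV[R]_n) :
  nbhs x P <-> exists2 d : R, 0 < d & forall h, enorm h < d -> P (x + h).
Proof.
split=> [/nbhs_ballP [d /= d0 dP]|[d d0 dP]].
  exists d => // h hd; apply: dP; rewrite -ball_normE /ball_ /=.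
  by rewrite opprD addNKr normrN (le_lt_trans (norm_enorm _ _)).
have n1 : (0 : R) < n%:R + 1 by rewrite ltr_wpDl.
apply/nbhs_ballP; exists (d / (n%:R + 1)); first by rewrite /= divr_gt0.
move=> y; rewrite -ball_normE /ball_ /= distrC ltr_pdivlMr // mulrC => yd.
rewrite -(addrNK x y) addrC; apply: dP; apply: le_lt_trans yd.
exact: enorm_norm.
Qed.

Lemma differentiable_eps (V W : normedModType R) (f : V -> W)
    (df : {linear V -> W}) x :
  continuous df ->
  (forall e : R, 0 < e ->
    \forall h \near (0 : V), `|f (h + x) - (f x + df h)| <= e * `|h|) ->
  differentiable f x /\ 'd f x = df :> (V -> W).
Proof.
move=> dc fdf.
have H : f \o shift x = cst (f x) + df +o_ 0 id.
  by apply/eqaddoP => e e0; exact: fdf.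
have dE := diff_unique dc H.
by split=> //; apply/diff_locallyP; rewrite dE.
Qed.

(** This epsilon-delta form is the working interface: the calculus rules below are proved by it,
    without little-o notation. *)
Lemma gradient_atP n (f : 'cV[R]_n -> R) x g : gradient_at f x g <->
  forall e : R, 0 < e -> exists2 d : R, 0 < d & forall h, enorm h < d ->
    `|f (x + h) - f x - dotv g h| <= e * enorm h.
Proof.
have n1 : (0 : R) < n%:R + 1 by rewrite ltr_wpDl.
split=> [[/diff_locally df dfg] e e0|fg].
  have {}df := (eqaddoP _ _ _ _).1 df.
  have /df /nbhs_enormP [d d0 dP] : 0 < e by [].
  exists d => // h /dP; rewrite add0r => h1.
  have {}h1 : `|f (h + x) - (f x + 'd f x h)| <= e * `|h| by [].
  rewrite (addrC x) -dfg -addrA -opprD; apply: (le_trans h1).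
  by rewrite ler_pM2l // norm_enorm.
have dl : linear (dotv g) by move=> a u v; rewrite dotvDr dotvZr.
pose dM := GRing.isLinear.Build _ _ _ _ _ dl.
pose dL : {linear 'cV[R]_n -> R} := HB.pack (dotv g) dM.
have dc : continuous dL.
  move=> z.
  apply: (proj2 (@cvgrPdist_le _ _ _ _ (nbhs_filter z) dL (dL z))) => e e0.
  apply/nbhs_enormP.
  have g1 : 0 < enorm g + 1 by rewrite ltr_wpDl // enorm_ge0.
  exists (e / (enorm g + 1)); first by rewrite divr_gt0.
  move=> h; rewrite ltr_pdivlMr // => hd.
  rewrite /dL /= dotvDr opprD addNKr normrN.
  apply: (le_trans (dotv_norm_le _ _)); apply: le_trans (ltW hd).
  by rewrite mulrC ler_wpM2l ?enorm_ge0 // lerDl.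
suff [df dE] : differentiable f x /\ 'd f x = dL :> (_ -> _).
  by split=> // h; rewrite dE.
apply: differentiable_eps dc _ => e e0; apply/nbhs_enormP.
have [d d0 dP] := fg (e / (n%:R + 1)) (divr_gt0 e0 n1).
  exists d => // h /dP; rewrite add0r => h1.
  suff : `|f (h + x) - (f x + dotv g h)| <= e * `|h| by [].
  rewrite (addrC h) opprD addrA; apply: (le_trans h1).
  by rewrite mulrAC ler_pdivrMr // -mulrA ler_pM2l // mulrC enorm_norm.
Qed.

Lemma gradient_at_uniq n (f : 'cV[R]_n -> R) x g g' :
  gradient_at f x g -> gradient_at f x g' -> g = g'.
Proof. by move=> [_ gE] [_ g'E]; apply: dotv_inj => h; rewrite -gE g'E. Qed.

Lemma grad_eq n (f : 'cV[R]_n -> R) x g : gradient_at f x g -> grad f x = g.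
Proof.
move=> fg; rewrite /grad; case: xgetP => [g' _ /gradient_at_uniq|/(_ g)//].
by apply.
Qed.

(** The coordinates of the gradient are the values of the differential on the basis vectors, so the
    default value of [xget] is never taken. *)
Lemma gradient_at_grad n (f : 'cV[R]_n -> R) x :
  differentiable f x -> gradient_at f x (grad f x).
Proof.
move=> df; rewrite /grad; case: xgetP => [g -> //|nog]; exfalso.
apply: (nog (\col_i 'd f x (delta_mx i 0))); split=> // h.
rewrite [in LHS](matrix_sum_delta h) linear_sum.
by apply: eq_bigr => i _; rewrite big_ord1 linearZ mxE mulrC.
Qed.

Lemma gradient_at_cvg n (f : 'cV[R]_n -> R) x g : gradient_at f x g ->
  forall e : R, 0 < e ->
    exists2 d : R, 0 < d & forall h, enorm h < d -> `|f (x + h) - f x| < e.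
Proof.
move=> [/differentiable_continuous fc _] e e0.
have {}fc := proj1 (@cvgrPdist_lt _ _ _ _ (nbhs_filter x) f (f x)) fc e e0.
have [d d0 dP] := (nbhs_enormP _ _ _).1 fc.
by exists d => // h /dP /=; rewrite distrC.
Qed.

Lemma gradient_at_line n (f : 'cV[R]_n -> R) z h g (t : R) :
  gradient_at f (z + t *: h) g ->
  is_derive t 1 (fun s => f (z + s *: h)) (dotv g h).
Proof.
move=> [df dfE].
have E : (fun s : R => s^-1 *:
     (((fun s => f (z + s *: h)) \o shift t) (s *: 1) - f (z + t *: h))) =
   (fun s : R => s^-1 *: ((f \o shift (z + t *: h)) (s *: h) - f (z + t *: h))).
  apply/funext => s; rewrite /= [in LHS]scalerDl addrCA /GRing.scale /=.
  by rewrite mulr1.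
split; first by rewrite /derivable E; exact: diff_derivable.
by rewrite /derive E -dfE -deriveE.
Qed.

Lemma is_derive_quad (a b t : R) :
  is_derive t 1 (fun s => s * a + s ^+ 2 * b) (a + 2 * t * b).
Proof.
have did := is_derive_id t (1 : R).
have da := is_deriveM did (is_derive_cst a t 1).
have db := is_deriveM (is_deriveX 2 did) (is_derive_cst b t 1).
have := is_deriveD da db.
set f := (X in is_derive _ _ X _); set df := (X in is_derive _ _ _ X) => H.
have -> : (fun s => s * a + s ^+ 2 * b) = f by apply/funext => s.
suff -> : a + 2 * t * b = df by [].
by rewrite /df /GRing.scale /= expr1; ring.
Qed.

(** Descent lemma. The mean value theorem is applied on [0, 1] to f along the segment minus its
    quadratic bound; the derivative of this difference is nonpositive by Cauchy-Schwarz and the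
    Lipschitz condition. *)
Lemma lipschitz_gradient_ub n (f : 'cV[R]_n -> R) (L : R) :
  (forall z, differentiable f z) ->
  (forall a b, enorm (grad f a - grad f b) <= L * enorm (a - b)) ->
  forall z h, f (z + h) <= f z + dotv (grad f z) h + L / 2 * enorm h ^+ 2.
Proof.
move=> df lip z h.
pose xi t := f (z + t *: h) -
  (t * dotv (grad f z) h + t ^+ 2 * (L / 2 * enorm h ^+ 2)).
pose dxi t := dotv (grad f (z + t *: h)) h -
  (dotv (grad f z) h + 2 * t * (L / 2 * enorm h ^+ 2)).
have dxiP (t : R) : is_derive t 1 xi (dxi t).
  have d1 := gradient_at_line _ f z h _ t (gradient_at_grad _ f _ (df _)).
  exact: (is_deriveB d1 (is_derive_quad _ _ t)).
have xic : {within `[0, 1], continuous xi}.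
  by apply: derivable_within_continuous => t _; have [] := dxiP t.
have [c] := @MVT R xi dxi 0 1 ltr01 (fun t _ => dxiP t) xic.
rewrite in_itv /= => /andP[c0 c1].
rewrite /xi scale1r scale0r addr0 => h1.
suff : dxi c <= 0 by move=> h2; move: h1; rewrite subr0 mulr1; lra.
rewrite /dxi; have := dotv_le (grad f (z + c *: h) - grad f z) h.
have := lip (z + c *: h) z.
rewrite (_ : z + c *: h - z = c *: h); last by rewrite addrC addKr.
rewrite enormZ (gtr0_norm c0).
move: (grad f (z + c *: h)) (grad f z) => G1 G0 l1 l2.
have : dotv (G1 - G0) h <= L * (c * enorm h) * enorm h.
  by apply: (le_trans l2); rewrite ler_wpM2r ?enorm_ge0.
by rewrite dotvDl dotvNl; lra.
Qed.

End Gradient.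

(** * The scalar penalty and its weight [omega] *)

Section Penalty.
Context {R : realType}.
Variable psi : R -> R.
Hypothesis psi_derivable : forall t, derivable psi t 1.
Hypothesis psi_concave : concave_on_nonneg (fun t => psi (Num.sqrt t)).
Variable om : R.
Hypothesis psi_deriv_bound :
  forall t, 0 < t -> 0 <= derive1 psi t <= om * t.
Hypothesis psi_deriv_cvg : cvg ((fun t => derive1 psi t / t) @ 0^'+).

Lemma is_derive_derive1 (t : R) : is_derive t 1 psi (derive1 psi t).
Proof. by split=> //; rewrite derive1E. Qed.

Lemma omega0_lim (e : R) : 0 < e -> exists2 d : R, 0 < d &
  forall t, 0 < t < d -> `|derive1 psi t - omega psi 0 * t| <= e * t.
Proof.
move=> e0; rewrite /omega eqxx.
have /cvgrPdist_le /(_ e e0) := psi_deriv_cvg.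
move=> /nbhs_ballP [d /= d0 dP]; exists d => // t /andP[t0 td].
have := dP t; rewrite -ball_normE /ball_ /= sub0r normrN gtr0_norm //.
move=> /(_ td t0); set l := lim _; move=> lt.
have tn0 : t != 0 by rewrite gt_eqF.
rewrite distrC -[X in _ - X](divfK tn0) -mulrBl normrM (gtr0_norm t0).
by rewrite ler_pM2r.
Qed.

(** For t = 0 the bounds are read off at the nearby positive point d / 2, up to an arbitrary slack
    e. *)
Lemma omega_bound t : 0 <= t -> 0 <= omega psi t <= om.
Proof.
rewrite le_eqVlt => /orP[/eqP <-|t0]; last first.
  rewrite /omega gt_eqF //=; have /andP[p0 p1] := psi_deriv_bound _ t0.
  by rewrite divr_ge0 ?(ltW t0) //= ler_pdivrMr.
suff H e : 0 < e -> - e <= omega psi 0 <= om + e.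
  apply/andP; split; last by apply/ler_addgt0Pr => e /H /andP[].
  apply/ler_addgt0Pr => e /H /andP[]; lra.
move=> e0; have [d d0 dP] := omega0_lim _ e0.
have d2 : 0 < d / 2 by rewrite divr_gt0.
have := dP (d / 2); rewrite d2 ltr_pdivrMr // ltr_pMr // ltr1n => /(_ isT).
have /andP[] := psi_deriv_bound _ d2.
move: (derive1 psi _) (omega psi 0) => a w.
rewrite ler_norml => a0 a1 /andP[b0 b1].
have h1 : 0 <= (w + e) * (d / 2) by lra.
have h2 : 0 <= (om + e - w) * (d / 2) by lra.
move: h1 h2; rewrite !pmulr_lge0 //; lra.
Qed.

(** The map u |-> psi (sqrt u) has slope [omega psi t / 2] at u = t^2. The side condition
    [0 <= t ^+ 2 + r] makes the statement one-sided at t = 0, where sqrt itself is not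
    differentiable. *)
Lemma omega_expansion t e : 0 <= t -> 0 < e -> exists2 d : R, 0 < d &
  forall r, `|r| < d -> 0 <= t ^+ 2 + r ->
    `|psi (Num.sqrt (t ^+ 2 + r)) - psi t - omega psi t / 2 * r| <= e * `|r|.
Proof.
rewrite le_eqVlt => /orP[/eqP <-|t0] e0.
  have [d d0 dP] := omega0_lim _ e0.
  exists (d ^+ 2); first exact: exprn_gt0.
  move=> r; rewrite expr0n add0r => rd r0; rewrite (ger0_norm r0) in rd *.
  have [->|rn0] := eqVneq r 0.
    by rewrite sqrtr0 subrr mulr0 subr0 normr0 mulr0.
  have s0 : 0 < Num.sqrt r by rewrite sqrtr_gt0 lt_def rn0.
  have sd : Num.sqrt r < d.
    by rewrite -(ltr_pXn2r (n:=2)) ?nnegrE ?ltW // sqr_sqrtr.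
  have -> : r = Num.sqrt r ^+ 2 by rewrite sqr_sqrtr.
  rewrite sqrtr_sqr (gtr0_norm s0); move: (Num.sqrt r) s0 sd => s s0 sd.
  (* At t = 0, the mean value theorem on [0, s] is applied to psi minus its expected quadratic part;
     [omega0_lim] makes the derivative of the difference at most e u. *)
  pose chi u := psi u - (u * 0 + u ^+ 2 * (omega psi 0 / 2)).
  pose dchi u := derive1 psi u - (0 + 2 * u * (omega psi 0 / 2)).
  have dchiP (u : R) : is_derive u 1 chi (dchi u).
    exact: (is_deriveB (is_derive_derive1 u)
      (is_derive_quad 0 (omega psi 0 / 2) u)).
  have chic : {within `[0, s], continuous chi}.
    by apply: derivable_within_continuous => u _; have [] := dchiP u.
  have [u] := @MVT R chi dchi 0 s s0 (fun u _ => dchiP u) chic.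
  rewrite in_itv /= => /andP[u0 us]; rewrite /chi /dchi => E.
  have {E} -> : psi s - psi 0 - omega psi 0 / 2 * s ^+ 2 =
      (derive1 psi u - omega psi 0 * u) * s.
    by move: E; move: (derive1 psi u) (omega psi 0) => a w; lra.
  rewrite normrM (gtr0_norm s0) expr2 mulrA ler_pM2r //.
  have := dP u; rewrite u0 (lt_trans us sd) => /(_ isT) h; apply: (le_trans h).
  by rewrite ler_pM2l // ltW.
(* For t > 0 the expansion is the chain rule for psi o sqrt at t^2. *)
have t2 : 0 < t ^+ 2 by rewrite exprn_gt0.
have d1 := is_derive1_sqrt t2.
have E : Num.sqrt (t ^+ 2) = t by rewrite sqrtr_sqr gtr0_norm.
have d2 : is_derive (Num.sqrt (t ^+ 2)) 1 psi (derive1 psi t).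
  by rewrite E; exact: is_derive_derive1.
have [/derivable_nbhs d3 d4] := is_derive1_comp d2 d1.
have {}d3 := (eqaddoP _ _ _ _).1 d3.
have {d3} /d3 /nbhs_ballP [d /= d0 dP] : 0 < e by [].
exists d => // r rd tr0; have := dP r.
rewrite -ball_normE /ball_ /= sub0r normrN => /(_ rd) h.
have {h} : `|psi (Num.sqrt (r *: 1 + t ^+ 2)) - (psi (Num.sqrt (t ^+ 2)) +
  r *: 'D_1 (psi \o Num.sqrt) (t ^+ 2))| <= e * `|r| by [].
rewrite d4 E /omega (gt_eqF t0) /GRing.scale /= mulr1 opprD addrA (addrC r).
congr (`|_ - _| <= _); rewrite invfM; ring.
Qed.

(* u |-> psi (sqrt u) lies below its tangent at u = t^2, of slope omega(t)/2. *)
Lemma psi_majorant s t : 0 <= s -> 0 <= t ->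
  psi s <= psi t + omega psi t / 2 * (s ^+ 2 - t ^+ 2).
Proof.
move=> s0 t0; apply/ler_addgt0Pr => e e0.
set v := s ^+ 2 - t ^+ 2.
have v1 : 0 < `|v| + 1 by rewrite ltr_wpDl.
have [d d0 dP] := omega_expansion _ _ t0 (divr_gt0 e0 v1).
(* A weight l so small that l v is within range of the expansion at t^2. Concavity bounds the same
   value from below by the chord; comparing the two and dividing by l gives the claim up to e. *)
pose l := Num.min 1 (d / 2 / (`|v| + 1)).
have l0 : 0 < l by rewrite lt_min ltr01 /= !divr_gt0.
have l1 : l <= 1 by rewrite ge_min lexx.
have lv : `|l * v| < d.
  rewrite normrM (gtr0_norm l0); apply: (@le_lt_trans _ _ (d / 2)); last lra.
  rewrite (@le_trans _ _ (l * (`|v| + 1))) // ?ler_pM2l // ?lerDl //.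
  by rewrite -ler_pdivlMr // ge_min lexx orbT.
have E : t ^+ 2 + l * v = l * s ^+ 2 + (1 - l) * t ^+ 2 by rewrite /v; ring.
have u0 : 0 <= t ^+ 2 + l * v.
  by rewrite E addr_ge0 // mulr_ge0 ?sqr_ge0 ?subr_ge0 // ltW.
have := psi_concave (s ^+ 2) (t ^+ 2) l (sqr_ge0 _) (sqr_ge0 _).
rewrite l1 (ltW l0) => /(_ isT); rewrite -E !sqrtr_sqr !ger0_norm //.
have := dP _ lv u0; rewrite normrM (gtr0_norm l0) ler_norml => /andP[_].
have : e / (`|v| + 1) * (l * `|v|) <= l * e.
  rewrite mulrCA ler_pM2l // mulrAC ler_pdivrMr // ler_pM2l // lerDl //.
move: (psi _) (psi s) (psi t) (omega psi t) => A B C w h1 h2 h3.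
have : 0 <= l * (C + w / 2 * v + e - B) by lra.
by rewrite pmulr_rge0 // subr_ge0.
Qed.

End Penalty.

(** * Gradient rules for sums, affine substitutions and radial penalties *)

Section GradientCalculus.
Context {R : realType}.

Lemma gradient_atD n (f f' : 'cV[R]_n -> R) x g g' :
  gradient_at f x g -> gradient_at f' x g' ->
  gradient_at (fun z => f z + f' z) x (g + g').
Proof.
move=> /gradient_atP fg /gradient_atP fg'; apply/gradient_atP => e e0.
have e2 : 0 < e / 2 by rewrite divr_gt0.
have [d d0 dP] := fg _ e2; have [d' d'0 dP'] := fg' _ e2.
exists (Num.min d d'); first by rewrite lt_min d0 d'0.
move=> h; rewrite lt_min => /andP[/dP h1 /dP' h2].
have -> : f (x + h) + f' (x + h) - (f x + f' x) - dotv (g + g') h =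
   (f (x + h) - f x - dotv g h) + (f' (x + h) - f' x - dotv g' h).
  by rewrite dotvDl; ring.
apply: (le_trans (ler_normD _ _)); move: h1 h2; move: (`|_|) (`|_|) => a b; lra.
Qed.

Lemma gradient_at_sum n (I : finType) (f : I -> 'cV[R]_n -> R) x g :
  (forall i, gradient_at (f i) x (g i)) ->
  gradient_at (fun z => \sum_i f i z) x (\sum_i g i).
Proof.
move=> fg.
rewrite (_ : (fun z => _) = \sum_i f i); last first.
  by apply/funext => z; rewrite fct_sumE.
elim/big_rec2: _ => [|i F G _ FG]; last exact: gradient_atD.
apply/gradient_atP => e e0; exists 1 => // h _.
suff : `|0 - 0 - dotv 0 h| <= e * enorm h by [].
by rewrite dotv0l !subr0 normr0 mulr_ge0 ?enorm_ge0 // ltW.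
Qed.

Lemma gradient_at_mulmx m n (f : 'cV[R]_m -> R) (A : 'M[R]_(m, n)) b x g :
  gradient_at f (A *m x - b) g ->
  gradient_at (fun z => f (A *m z - b)) x (A^T *m g).
Proof.
move=> /gradient_atP fg; apply/gradient_atP => e e0.
have [C C0 AC] := mulmx_enorm _ _ A.
have [d d0 dP] := fg _ (divr_gt0 e0 C0).
exists (d / C); first by rewrite divr_gt0.
move=> h; rewrite ltr_pdivlMr // mulrC => hd.
have := dP _ (le_lt_trans (AC h) hd).
rewrite dotv_mulmxl trmxK mulmxDr (addrAC (A *m x)) => h1; apply: (le_trans h1).
by rewrite mulrAC ler_pdivrMr // -mulrA ler_pM2l // mulrC.
Qed.

Lemma gradient_at_sqr n (z : 'cV[R]_n) :
  gradient_at (fun z => enorm z ^+ 2) z (2 *: z).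
Proof.
apply/gradient_atP => e e0; exists e => // h he.
rewrite enorm_sqrD dotvZl.
have -> : forall a b c : R, a + 2 * b + c - a - 2 * b = c by move=> *; ring.
by rewrite ger0_norm ?sqr_ge0 // expr2 ler_wpM2r ?enorm_ge0 // ltW.
Qed.

Section RadialPenalty.
Variables (psi : R -> R) (om : R).
Hypothesis psi_derivable : forall t, derivable psi t 1.
Hypothesis psi_concave : concave_on_nonneg (fun t => psi (Num.sqrt t)).
Hypothesis psi_deriv_bound :
  forall t, 0 < t -> 0 <= derive1 psi t <= om * t.
Hypothesis psi_deriv_cvg : cvg ((fun t => derive1 psi t / t) @ 0^'+).

(** Expanding psi as a function of the squared norm treats z = 0, where the norm is not
    differentiable, together with all other points. *)
Lemma gradient_at_enorm n (z : 'cV[R]_n) :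
  gradient_at (fun z => psi (enorm z)) z (omega psi (enorm z) *: z).
Proof.
apply/gradient_atP => e e0.
set t := enorm z; have t0 : 0 <= t by exact: enorm_ge0.
set w := omega psi t.
have /andP[w0 _] : 0 <= w <= om by exact: omega_bound.
pose K := 2 * t + 1.
have K0 : 0 < K by rewrite ltr_wpDl // mulr_ge0.
have eK : 0 < e / (2 * K) by rewrite divr_gt0 // mulr_gt0.
have [d d0 dP] := omega_expansion psi psi_derivable psi_deriv_cvg _ _ t0 eK.
(* The three bounds serve in turn to get |r| <= K |h|, to have |r| < d, and to absorb the
   second-order term w |h|^2 / 2 into e |h| / 2. *)
exists (Num.min 1 (Num.min (d / K) (e / (w + 1)))).
  by rewrite !lt_min ltr01 !divr_gt0 // ltr_wpDl.
move=> h; rewrite !lt_min => /and3P[h1 hd he].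
set s := enorm h in h1 hd he *; have s0 : 0 <= s by exact: enorm_ge0.
pose r := 2 * dotv z h + s ^+ 2.
have E : enorm (z + h) = Num.sqrt (t ^+ 2 + r).
  by rewrite /r addrA -enorm_sqrD sqrtr_sqr ger0_norm // enorm_ge0.
have ge0 : 0 <= t ^+ 2 + r by rewrite /r addrA -enorm_sqrD sqr_ge0.
have rK : `|r| <= K * s.
  apply: (le_trans (ler_normD _ _)); rewrite normrM (ger0_norm (sqr_ge0 _)).
  have := dotv_norm_le z h; rewrite -/t -/s (ger0_norm (ler0n R 2)) /K.
  move: (`|dotv z h|) => a; nra.
have rd : `|r| < d.
  by apply: (le_lt_trans rK); rewrite mulrC -ltr_pdivlMr.
have := dP _ rd ge0; rewrite -E -/w => H.
rewrite dotvZl; move: (psi _) (psi t) H => A B H.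
have -> : A - B - w * dotv z h = (A - B - w / 2 * r) + w / 2 * s ^+ 2.
  by rewrite /r; field.
apply: (le_trans (ler_normD _ _)).
rewrite (ger0_norm (mulr_ge0 (divr_ge0 w0 _) (sqr_ge0 _))) //.
have H2 : e / (2 * K) * `|r| <= e / 2 * s.
  have -> : e / 2 * s = e / (2 * K) * (K * s) by field; rewrite gt_eqF.
  by rewrite ler_pM2l.
have H3 : w / 2 * s ^+ 2 <= e / 2 * s.
  move: he; rewrite ltr_pdivlMr ?ltr_wpDl // => he.
  have : 0 <= (e - s * (w + 1)) * s by rewrite mulr_ge0 // subr_ge0 ltW.
  nra.
move: H H2 H3; move: (`|A - _ - _|) (e / _ * `|r|) => a b; lra.
Qed.

End RadialPenalty.
End GradientCalculus.

(** * The desingularising power, cluster points and first-order optimality *)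

Section KurdykaLojasiewicz.
Context {R : realType}.

(** The tangent inequality of the concave power u^p at r, multiplied by r^(1 - p) so that s = 0 is
    allowed and no negative power appears. *)
Lemma powR_tangent (r s p : R) : 0 <= s -> 0 < r -> 0 < p <= 1 ->
  p * (r - s) <= r `^ (1 - p) * (r `^ p - s `^ p).
Proof.
move=> s0 r0 /andP[p0 p1].
have rE : r `^ (1 - p) * r `^ p = r.
  by rewrite -powRD ?subrK ?powRr1 ?ltW // oner_eq0.
rewrite [leRHS]mulrBr rE; move: s0; rewrite le_eqVlt => /orP[/eqP <-|s0].
  by rewrite powR0 ?gt_eqF // mulr0 !subr0 ler_piMl // ltW.
(* What remains is the weighted arithmetic-geometric inequality r^(1 - p) s^p <= m, which follows
   from ln u <= u - 1 at u = r / m and u = s / m. *)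
pose m := (1 - p) * r + p * s.
have m0 : 0 < m.
  by rewrite /m ltr_wpDl ?mulr_gt0 // mulr_ge0 ?subr_ge0 ?(ltW r0).
have lnb u : 0 < u -> ln u - ln m <= u / m - 1.
  move=> u0; rewrite -ln_div ?posrE // -[X in ln X](subrK 1) addrC.
  by apply: le_ln1Dx; rewrite ltrBDr addrC subrr divr_gt0.
suff : r `^ (1 - p) * s `^ p <= m by rewrite /m; move: (_ `^ _ * _) => z; lra.
rewrite /powR !gt_eqF // -expRD -ler_ln ?posrE ?expR_gt0 // expRK.
have h1 := lnb _ r0; have h2 := lnb _ s0.
have : (1 - p) * (ln r - ln m) + p * (ln s - ln m) <=
       (1 - p) * (r / m - 1) + p * (s / m - 1).
  by rewrite lerD // ler_wpM2l ?subr_ge0 // ltW.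
have -> : (1 - p) * (r / m - 1) + p * (s / m - 1) = 0.
  have -> : (1 - p) * (r / m - 1) + p * (s / m - 1) = m / m - 1.
    by rewrite {3}/m; field; rewrite gt_eqF.
  by rewrite divff ?gt_eqF // subrr.
by move: (ln r) (ln s) (ln m) => *; lra.
Qed.

(** Here r and s stand for two successive gaps in F, e for the step length and g for the gradient
    norm. The tangent inequality at r is combined with r - s >= c e g >= c kappa e r^theta, and
    r^theta cancels. For r = 0 also s = 0, and the last hypothesis gives e = 0. *)
Lemma KL_step (r s e g c kappa theta : R) :
  0 <= s <= r -> 0 <= theta < 1 -> 0 < c -> 0 < kappa -> 0 <= e ->
  kappa * r `^ theta <= g -> c * (e * g) <= r - s -> (r = s -> e = 0) ->
  (1 - theta) * (c * kappa) * e <= r `^ (1 - theta) - s `^ (1 - theta).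
Proof.
move=> /andP[s0 sr] /andP[t0 t1] c0 k0 e0 kg ceg rse.
have := le_trans s0 sr; rewrite le_eqVlt => /orP[/eqP r0|r0].
  have E : r = s by apply/eqP; rewrite eq_le sr -r0 s0.
  by rewrite rse // -E mulr0 subrr.
have p01 : 0 < 1 - theta <= 1 by rewrite subr_gt0 t1 gerBl.
have := powR_tangent _ _ _ s0 r0 p01.
rewrite (_ : 1 - (1 - theta) = theta); last by ring.
have rt : 0 < r `^ theta by rewrite powR_gt0.
move: (r `^ theta) rt kg (r `^ (1 - theta)) (s `^ (1 - theta)) => w w0 kg A B h.
rewrite -(ler_pM2l w0); apply: le_trans h; move/andP: p01 => [p0 _].
have -> : w * ((1 - theta) * (c * kappa) * e) =
  (1 - theta) * (c * (e * (kappa * w))) by ring.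
rewrite ler_pM2l //; apply: le_trans ceg.
by rewrite ler_pM2l // ler_wpM2l.
Qed.

(** Bolzano-Weierstrass, through compactness of a product of segments; the transposition turns
    columns into the rows for which that compactness is stated. *)
Lemma bounded_cluster n (x : nat -> 'cV[R]_n) (r : R) :
  (forall k, enorm (x k) <= r) ->
  exists xt, forall e : R, 0 < e -> forall m, exists2 k, (m <= k)%N &
    enorm (x k - xt) < e.
Proof.
move=> xr.
pose A := [set v : 'rV[R]_n | forall i, `[- r, r]%classic (v ord0 i)].
have cA : compact A.
  apply: (@rV_compact _ _ (fun=> `[- r, r]%classic)) => i.
  exact: segment_compact.
have FA : ((fun k => (x k)^T) @ \oo) A.
  exists 0%N => // k _ i /=; rewrite in_itv /= mxE -ler_norml.
  by apply: le_trans (xr k); exact: coord_enorm.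
have [p [_ clp]] := cA _ _ FA.
exists p^T => e e0 m.
have n1 : (0 : R) < n%:R + 1 by rewrite ltr_wpDl.
have := clp [set (x k)^T | k in [set k | (m <= k)%N]] (ball p (e / (n%:R + 1))).
case.
- by exists m => // k mk; exists k.
- by apply: nbhsx_ballx; rewrite divr_gt0.
move=> v [[k mk <-]]; rewrite mx_norm_ball /ball_ /= ltr_pdivlMr // mulrC => h.
exists k => //; apply: le_lt_trans h; apply: enorm_sup => // i.
rewrite [leRHS]mx_normrE.
apply: le_trans (le_bigmax _ (fun ij => `|(p - (x k)^T) ij.1 ij.2|) (0, i)).
by rewrite !mxE distrC.
Qed.

Lemma quadratic_max_grad0 n (F : 'cV[R]_n -> R) x g eta :
  gradient_at F x g -> (forall h, F (x + h) <= F x + eta * enorm h ^+ 2) ->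
  g = 0.
Proof.
move=> /gradient_atP Fg Fub; apply: enorm_eq0; apply/eqP/negPn/negP => g0.
have g_gt0 : 0 < enorm g by rewrite lt_def g0 enorm_ge0.
have [d d0 dP] := Fg _ (divr_gt0 g_gt0 (ltr0n R 4)).
have eta1 : 0 < `|eta| + 1 by rewrite ltr_wpDl.
(* Moving by s g raises F by at least (3/4) s |g|^2, as the linearisation error is at most s |g|^2 /
   4, while s |eta| <= 1/2 caps the rise at half of s |g|^2. *)
pose s := Num.min (d / (2 * enorm g)) (1 / (2 * (`|eta| + 1))).
have s0 : 0 < s by rewrite lt_min !divr_gt0 // mulr_gt0.
have sd : enorm (s *: g) < d.
  rewrite enormZ (gtr0_norm s0).
  have : s <= d / (2 * enorm g) by rewrite ge_min lexx.
  rewrite ler_pdivlMr ?mulr_gt0 //; move: (enorm g) => G; lra.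
have seta : s * (2 * (`|eta| + 1)) <= 1.
  by rewrite -ler_pdivlMr ?mulr_gt0 // ge_min lexx orbT.
have := dP _ sd; rewrite ler_norml => /andP[+ _].
have := Fub (s *: g); rewrite enormZ (gtr0_norm s0) dotvZr -enorm_sqr.
move: (enorm g) g_gt0 (F _) (F x) => G G0 A B h1 h2.
have h3 : 0 <= s * G ^+ 2 * (eta * s + 4^-1 - 1) by lra.
have : 0 <= eta * s + 4^-1 - 1.
  by move: h3; rewrite pmulr_rge0 // mulr_gt0 // exprn_gt0.
have := ler_norm eta; nra.
Qed.

(** * Convergence of descent sequences under the Kurdyka-Lojasiewicz inequality *)

Section Descent.
Variables (n : nat) (F : 'cV[R]_n -> R) (x : nat -> 'cV[R]_n).
Variables a b eta r0 : R.
Hypotheses (a0 : 0 < a) (b0 : 0 < b) (eta0 : 0 <= eta).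
Hypothesis F_grad : forall z, gradient_at F z (grad F z).
Hypothesis F_ub :
  forall z h, F (z + h) <= F z + dotv (grad F z) h + eta * enorm h ^+ 2.
Hypothesis step_decrease :
  forall k, a * enorm (x k.+1 - x k) ^+ 2 <= F (x k) - F (x k.+1).
Hypothesis grad_decrease :
  forall k, b * enorm (grad F (x k)) ^+ 2 <= F (x k) - F (x k.+1).

Lemma F_noninc k m : (k <= m)%N -> F (x m) <= F (x k).
Proof.
move/subnKC <-; elim: (m - k)%N => [|j IH]; first by rewrite addn0.
rewrite addnS; apply: le_trans IH; rewrite -subr_ge0.
by apply: le_trans (step_decrease _); rewrite mulr_ge0 ?sqr_ge0 // ltW.
Qed.

Section ClusterPoint.
Variable xt : 'cV[R]_n.
Hypothesis xt_cluster : forall e : R, 0 < e ->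
  forall m, exists2 k, (m <= k)%N & enorm (x k - xt) < e.

Lemma F_cluster e m : 0 < e ->
  exists2 k, (m <= k)%N & enorm (x k - xt) < e /\ `|F (x k) - F xt| < e.
Proof.
move=> e0; have [d d0 dP] := gradient_at_cvg _ _ _ _ (F_grad xt) e e0.
have [|k mk] := xt_cluster (Num.min d e) _ m; first by rewrite lt_min d0 e0.
rewrite lt_min => /andP[kd ke]; exists k => //; split=> //.
by have := dP _ kd; rewrite (addrC xt) subrK.
Qed.

Lemma F_cluster_le k : F xt <= F (x k).
Proof.
apply/ler_addgt0Pr => e e0; have [m km [_]] := F_cluster _ k e0.
rewrite ltr_norml => /andP[h _]; have := F_noninc _ _ km; lra.
Qed.

Lemma grad_cluster0 : grad F xt = 0.
Proof.
apply: (quadratic_max_grad0 _ _ _ _ eta (F_grad xt)) => h.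
(* C collects the errors of the limit passage: for d <= 1, d (d + s) + d + eta ((d + s)^2 - s^2) <=
   d C. *)
apply/ler_addgt0Pr => e e0; set s := enorm h.
have s0 : 0 <= s by exact: enorm_ge0.
pose C := 2 + s + eta * (1 + 2 * s).
have C0 : 0 < C.
  by rewrite /C ltr_wpDr ?mulr_ge0 ?addr_ge0 ?mulr_ge0 // ltr_wpDr.
pose d := Num.min 1 (e / C).
have d0 : 0 < d by rewrite lt_min ltr01 divr_gt0.
have d1 : d <= 1 by rewrite ge_min lexx.
have dC : d * C <= e by rewrite -ler_pdivlMr // ge_min lexx orbT.
clearbody d.
(* The tolerance b d^2 on the values forces |grad F (x k)| <= d through [grad_decrease]. *)
have [|k _ []] := F_cluster (Num.min d (b * d ^+ 2)) 0%N.
  by rewrite lt_min d0 mulr_gt0 // exprn_gt0.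
rewrite !lt_min => /andP[xd _] /andP[Fd Fd2].
have gd : enorm (grad F (x k)) <= d.
  rewrite -(@ler_pXn2r _ 2) ?nnegrE ?enorm_ge0 ?(ltW d0) // -(ler_pM2l b0).
  apply: (le_trans (grad_decrease k)); apply: le_trans (ltW Fd2).
  by apply: le_trans (ler_norm _); rewrite lerD2l lerN2 F_cluster_le.
have Fk : F (x k) <= F xt + d.
  by move: Fd; rewrite ltr_norml => /andP[_ /ltW]; rewrite lerBlDl.
have := F_ub (x k) (xt - x k + h).
rewrite (_ : x k + (xt - x k + h) = xt + h); last first.
  by rewrite addrA [x k + _]addrC subrK.
have hn : enorm (xt - x k + h) <= d + s.
  by apply: (le_trans (enormD _ _)); rewrite lerD2r enormBC ltW.
have := dotv_le (grad F (x k)) (xt - x k + h).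
move: hn gd Fk (enorm_ge0 (xt - x k + h)) (enorm_ge0 (grad F (x k))).
move: (enorm (xt - x k + h)) (enorm (grad F (x k))) (dotv _ _) (F _) (F _) (F _).
move=> u v w A B B' hn gd Fk u0 v0 h1 h2.
have h3 : v * u <= d * (d + s).
  by apply: ler_pM.
have h4 : eta * u ^+ 2 <= eta * (d + s) ^+ 2.
  by rewrite ler_wpM2l // ler_pXn2r ?nnegrE // addr_ge0 // ltW.
have h5 : d ^+ 2 <= d by rewrite expr2 ger_pMr.
have h6 : eta * d ^+ 2 <= eta * d by rewrite ler_wpM2l.
rewrite /C in dC; nra.
Qed.

End ClusterPoint.

Hypothesis x_bounded : forall k, enorm (x k) <= r0.
Hypothesis F_KL : KL_ineq F.

Lemma descent_cvg : exists xt,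
  x k @[k --> \oo] --> xt /\ grad F xt = 0 /\
  (\sum_(0 <= k <oo) (enorm (x k.+1 - x k))%:E < +oo)%E.
Proof.
have [xt xt_cl] := bounded_cluster _ _ _ x_bounded.
exists xt.
have Fxt k : F xt <= F (x k).
  exact: (F_cluster_le xt xt_cl).
have Fcl := F_cluster xt xt_cl.
pose e k := enorm (x k.+1 - x k).
have e0 k : 0 <= e k by exact: enorm_ge0.
(* The ball of radius rho around xt contains every iterate, so only the condition on the values of F
   remains to be met in the inequality. *)
pose rho := r0 + enorm xt + 1.
have xE k : enorm (x k - xt) < rho.
  apply: (le_lt_trans (enormB _ _)); rewrite /rho -addrA ler_ltD ?x_bounded //.
  by rewrite ltrDl.
have [||kappa [zeta [theta [k0 z0 /andP[t0 t1] KL]]]] :=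
  F_KL xt [set z | enorm (z - xt) < rho].
- by exists rho; split=> //; exact: le_lt_trans (enorm_ge0 _) (xE 0%N).
- exists (rho + enorm xt) => z /= zr; rewrite -(subrK xt z).
  by rewrite (le_trans (enormD _ _)) // lerD2r ltW.
(* From index K on the gap in F stays below zeta, by monotonicity. *)
have [K _ [_ FK]] := Fcl _ 0%N z0.
pose p := 1 - theta; have p0 : 0 < p by rewrite subr_gt0.
pose phi k := (F (x k) - F xt) `^ p.
pose c := p * (Num.min a b * kappa).
have ab0 : 0 < Num.min a b by rewrite lt_min a0.
have c0 : 0 < c by rewrite !mulr_gt0.
have step k : (K <= k)%N -> c * e k <= phi k - phi k.+1.
  move=> Kk; apply: (KL_step _ _ _ (enorm (grad F (x k)))) => //.
  - by rewrite subr_ge0 Fxt lerD2r F_noninc.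
  - by rewrite t0.
  - have rk : `|F (x k) - F xt| = F (x k) - F xt.
      by rewrite ger0_norm // subr_ge0.
    rewrite -[X in X `^ _]rk; apply: KL; first exact: xE.
    rewrite rk; apply: le_lt_trans FK; apply: le_trans (ler_norm _).
    by rewrite lerD2r F_noninc.
  - rewrite opprB addrA subrK; have := step_decrease k; have := grad_decrease k.
    rewrite -/(e k); move: (e k) (enorm _) (_ - _) => u v w h1 h2.
    have h3 : Num.min a b * v ^+ 2 <= b * v ^+ 2.
      by rewrite ler_wpM2r ?sqr_ge0 // ge_min lexx orbT.
    have h4 : Num.min a b * u ^+ 2 <= a * u ^+ 2.
      by rewrite ler_wpM2r ?sqr_ge0 // ge_min lexx.
    (* With m the minimum of a and b, the decrease w dominates m u^2 and m v^2, hence m u v since 2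
       u v <= u^2 + v^2. *)
    have : 0 <= Num.min a b * (u - v) ^+ 2 by rewrite mulr_ge0 ?sqr_ge0 // ltW.
    have : 0 <= w by apply: le_trans h1; rewrite mulr_ge0 ?sqr_ge0 // ltW.
    lra.
  - move=> /addIr FE; have := step_decrease k; rewrite -/(e k) FE subrr.
    rewrite pmulr_rle0 // => ek; apply/eqP; rewrite -sqrf_eq0 eq_le ek.
    exact: sqr_ge0.
pose S m := \sum_(k < m) e k.
have Smono m j : S m <= S (m + j)%N.
  by rewrite /S big_split_ord /= lerDl sumr_ge0.
(* Telescoping [step]: the quantity c S + phi is nonincreasing from K on. *)
have Sphi m j : (K <= m)%N -> c * S (m + j)%N + phi (m + j)%N <= c * S m + phi m.
  move=> Km; elim: j => [|j]; first by rewrite addn0.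
  apply: le_trans; rewrite addnS /S big_ord_recr /= mulrDr.
  by have := step (m + j)%N (leq_trans Km (leq_addr _ _)); lra.
have xS m j : enorm (x (m + j)%N - x m) <= S (m + j)%N - S m.
  elim: j => [|j IH]; first by rewrite addn0 !subrr enorm0.
  rewrite addnS /S big_ord_recr /= -/(S _).
  rewrite -(subrK (x (m + j)%N) (x (m + j).+1)) -addrA.
  apply: (le_trans (enormD _ _)); rewrite -/(e _) -/(S m).
  move: IH; move: (enorm _) (S _) (S _) (e _) => A B C D; lra.
have phi0 k : 0 <= phi k by exact: powR_ge0.
split; last split.
- apply/(@cvgrPdist_lt _ _ _ _ _ x xt) => eps eps0.
  (* The first bound puts x m within eps / 2 of xt; the second makes phi m < c eps / 2, so the path
     after m is shorter than eps / 2. *)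
  pose d := Num.min (eps / 2) ((eps / 2 * c) `^ p^-1).
  have d0 : 0 < d by rewrite lt_min powR_gt0 ?mulr_gt0 ?divr_gt0.
  have [m Km [xm Fm]] := Fcl _ K d0.
  have phim : phi m < eps / 2 * c.
    have ep0 : 0 <= eps / 2 * c by rewrite mulr_ge0 ?ltW ?divr_gt0.
    have -> : eps / 2 * c = ((eps / 2 * c) `^ p^-1) `^ p.
      by rewrite -powRrM mulVf ?powRr1 // lt0r_neq0.
    apply: gt0_ltr_powR; rewrite ?nnegrE ?subr_ge0 ?powR_ge0 //.
    apply: (le_lt_trans (ler_norm _)); apply: lt_le_trans Fm _.
    by rewrite ge_min lexx orbT.
  exists m => // k /= mk; suff : `|xt - x k| < eps by [].
  rewrite -(subnKC mk).
  apply: (le_lt_trans (norm_enorm _ _)); rewrite enormBC.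
  rewrite -(subrK (x m) (x _)) -addrA; apply: (le_lt_trans (enormD _ _)).
  have h1 := xS m (k - m)%N; have h2 := Sphi m (k - m)%N Km.
  have h3 : S (m + (k - m))%N - S m < eps / 2.
    rewrite -(ltr_pM2r c0); apply: le_lt_trans phim.
    move: h2 (phi0 (m + (k - m))%N).
    by move: (S (m + (k - m))%N) (S m) (phi (m + (k - m))%N) (phi m) => *; lra.
  have h4 : enorm (x m - xt) < eps / 2.
    by apply: (lt_le_trans xm); rewrite ge_min lexx.
  by move: h1 h3 h4; move: (enorm _) (enorm _) (_ - S m) => *; lra.
- exact: (grad_cluster0 xt xt_cl).
- have Sb m : S m <= S K + phi K / c.
    have [mK|/ltnW Km] := leqP m K.
      have := Smono m (K - m)%N; rewrite subnKC // => h; apply: (le_trans h).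
      by rewrite lerDl divr_ge0 // ltW.
    have := Sphi K (m - K)%N (leqnn _); rewrite subnKC // => h.
    rewrite -lerBlDl ler_pdivlMr //; move: h (phi0 m).
    by move: (S m) (S K) (phi m) (phi K) => *; lra.
  apply: (@le_lt_trans _ _ (S K + phi K / c)%:E); last exact: ltry.
  apply: lime_le.
    by apply: is_cvg_nneseries => k _ _; rewrite lee_fin enorm_ge0.
  by apply: nearW => m; rewrite sumEFin lee_fin big_mkord; exact: Sb.
Qed.

End Descent.
End KurdykaLojasiewicz.

(** * Decrease estimates for the majorize-minimize step *)

Section MajorizeMinimize.
Context {R : realType}.
Variables (N : nat) (F : 'cV[R]_N -> R) (A : 'cV[R]_N -> 'M[R]_N) (nu eta : R).
Hypotheses (nu0 : 0 < nu) (eta0 : 0 < eta).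
Hypothesis A_sym : forall z, (A z)^T = A z.
Hypothesis A_lb : forall z v, nu * enorm v ^+ 2 <= dotv v (A z *m v).
Hypothesis A_ub : forall z v, dotv v (A z *m v) <= eta * enorm v ^+ 2.
Hypothesis F_majorant : forall z h,
  F (z + h) <= F z + dotv (grad F z) h + dotv h (A z *m h) / 2.

(** Since B s = D^T g, the displacement - D s minimises the quadratic model over the range of D. The
    model drops by <s, B s> / 2, which bounds the decrease of F from below and exceeds the drop for
    any competitor v. *)
Lemma mm_inner_decrease M (xk : 'cV[R]_N) (D : 'M[R]_(N, M)) j :
  let z i := xk + D *m mm_inner A (grad F) xk D i in
  nu / 2 * enorm (z j.+1 - z j) ^+ 2 <= F (z j) - F (z j.+1) /\
  forall v, - dotv (grad F (z j)) (D *m v) -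
      dotv (D *m v) (A (z j) *m (D *m v)) / 2
    <= F (z j) - F (z j.+1).
Proof.
move=> z; set zj := z j; set g := grad F zj.
pose B := D^T *m A zj *m D; pose s := Defs.pinv B *m (D^T *m g).
have zS : z j.+1 = zj + - (D *m s).
  by rewrite /z /mm_inner iterS -/(mm_inner _ _ _ _ j) mulmxBr addrA.
have Bs : B *m s = D^T *m g.
  apply: mulmx_pinv_range => // v Av0; apply: enorm_eq0; apply/eqP.
  rewrite -sqrf_eq0 eq_le sqr_ge0 andbT -(pmulr_rle0 _ nu0) -Av0.
  exact: A_lb.
have BE u w : dotv (D *m u) (A zj *m (D *m w)) = dotv u (B *m w).
  by rewrite dotv_mulmxl /B !mulmxA.
have B_sym : B^T = B by rewrite /B !trmx_mul trmxK A_sym mulmxA.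
have gD v : dotv g (D *m v) = dotv v (B *m s).
  by rewrite dotv_mulmxr Bs dotvC.
have := F_majorant zj (- (D *m s)); rewrite -zS -/g.
rewrite mulmxN !dotvNr dotvNl opprK gD BE => Fz.
set q := dotv s (B *m s) in Fz.
have Fq : q / 2 <= F zj - F (z j.+1).
  by move: (F _) (F _) Fz => x y *; lra.
split.
  apply: le_trans Fq; rewrite zS addrC addKr enormN /q -BE.
  by rewrite mulrAC ler_pM2r ?invr_gt0 //; exact: A_lb.
move=> v; apply: le_trans Fq; rewrite gD BE.
(* Completing the square: the optimal drop minus the drop at v is half of this form. *)
have : 0 <= dotv (s + v) (B *m (s + v)).
  by rewrite -BE; apply: le_trans (A_lb _ _); rewrite mulr_ge0 ?sqr_ge0 // ltW.
rewrite mulmxDr dotvDl !dotvDr -/q.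
have -> : dotv s (B *m v) = dotv v (B *m s) by rewrite dotv_mulmxr B_sym dotvC.
move: (dotv _ _) (dotv _ _) => x y; lra.
Qed.

Lemma mm_inner_noninc M (xk : 'cV[R]_N) (D : 'M[R]_(N, M)) j :
  F (xk + D *m mm_inner A (grad F) xk D j.+1) <=
  F (xk + D *m mm_inner A (grad F) xk D j).
Proof.
have [h _] := mm_inner_decrease M xk D j.
rewrite -subr_ge0; apply: le_trans h.
by rewrite mulr_ge0 ?sqr_ge0 // divr_ge0 // ltW.
Qed.

(** Induction on the inner iterations. The triangle inequality and (q + r)^2 <= 2 (q^2 + r^2) cost a
    factor 2 each time, so a depends on J but on neither the iterate nor the subspace. *)
Lemma mm_step_decrease J : exists2 a : R, 0 < a &
  forall M (xk : 'cV[R]_N) (D : 'M[R]_(N, M)),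
    a * enorm (mm_step J A (grad F) xk D - xk) ^+ 2 <=
    F xk - F (mm_step J A (grad F) xk D).
Proof.
rewrite /mm_step; elim: J => [|J [a a0 IH]].
  exists 1 => // M xk D.
  by rewrite /mm_inner /= mulmx0 addr0 !subrr enorm0 expr0n mulr0.
pose m := Num.min a (nu / 2).
have m0 : 0 < m by rewrite lt_min a0 divr_gt0.
exists (m / 2) => [|M xk D]; first by rewrite divr_gt0.
have [h2 _] := mm_inner_decrease M xk D J.
have h1 := IH M xk D; move: h1 h2.
set zJ := _ + _ *m mm_inner _ _ _ _ J; set zS := _ + _ *m mm_inner _ _ _ _ J.+1.
have : enorm (zS - xk) <= enorm (zS - zJ) + enorm (zJ - xk).
  by apply: le_trans (enormD _ _); rewrite addrA subrK.
move: (enorm_ge0 (zS - xk)) (enorm_ge0 (zS - zJ)) (enorm_ge0 (zJ - xk)).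
move: (enorm (zS - xk)) (enorm (zS - zJ)) (enorm (zJ - xk)) => p q r.
move: (F xk) (F zJ) (F zS) => x y z.
move=> p0 q0 r0 pqr h1 h2.
have h3 : m * r ^+ 2 <= a * r ^+ 2.
  by rewrite ler_wpM2r ?sqr_ge0 // ge_min lexx.
have h4 : m * q ^+ 2 <= nu / 2 * q ^+ 2.
  by rewrite ler_wpM2r ?sqr_ge0 // ge_min lexx orbT.
have : m / 2 * p ^+ 2 <= m * (q ^+ 2 + r ^+ 2).
  rewrite -mulrA ler_pM2l //.
  have : p ^+ 2 <= (q + r) ^+ 2 by rewrite ler_pXn2r ?nnegrE ?addr_ge0.
  have : 0 <= (q - r) ^+ 2 by exact: sqr_ge0.
  lra.
lra.
Qed.

Lemma mm_step_gradient J (gamma0 gamma1 : R) :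
  (0 < J)%N -> 0 < gamma0 -> 0 < gamma1 ->
  exists2 b : R, 0 < b &
  forall M (i : 'I_M) (xk : 'cV[R]_N) (D : 'M[R]_(N, M)),
    dotv (grad F xk) (col i D) <= - gamma0 * enorm (grad F xk) ^+ 2 ->
    enorm (col i D) <= gamma1 * enorm (grad F xk) ->
    b * enorm (grad F xk) ^+ 2 <= F xk - F (mm_step J A (grad F) xk D).
Proof.
move=> J0 g0 g1.
(* alpha maximises alpha * gamma0 - alpha^2 * eta * gamma1^2 / 2. *)
pose alpha := gamma0 / (eta * gamma1 ^+ 2).
have al0 : 0 < alpha by rewrite divr_gt0 // mulr_gt0 // exprn_gt0.
exists (alpha * gamma0 / 2); first by rewrite divr_gt0 // mulr_gt0.
move=> M i xk D gd dg.
(* Later inner iterations only decrease F, so it suffices to estimate the first one. *)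
have F1 j : F (mm_step j.+1 A (grad F) xk D) <= F (mm_step 1 A (grad F) xk D).
  elim: j => [|j IH]; first exact: lexx.
  by apply: le_trans IH; exact: (mm_inner_noninc M xk D j.+1).
case: J J0 => // J _; apply: le_trans (lerB (lexx _) (F1 J)).
have z0 : xk + D *m mm_inner A (grad F) xk D 0 = xk.
  by rewrite /mm_inner /= mulmx0 addr0.
have [_] := mm_inner_decrease M xk D 0; rewrite /mm_step z0.
(* The competitor is the step of length factor alpha along the distinguished column. *)
move=> /(_ (alpha *: delta_mx i 0)); rewrite -scalemxAr -colE.
apply: le_trans; have := A_ub xk (alpha *: col i D).
rewrite enormZ (gtr0_norm al0) dotvZr exprMn => h1.
have h2 : eta * (alpha ^+ 2 * enorm (col i D) ^+ 2) <=
    alpha * gamma0 * enorm (grad F xk) ^+ 2.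
  have -> : alpha * gamma0 * enorm (grad F xk) ^+ 2 =
      eta * (alpha ^+ 2 * (gamma1 * enorm (grad F xk)) ^+ 2).
    rewrite /alpha; move: (enorm (grad F xk)) => G; field.
    by rewrite !gt_eqF.
  rewrite ler_pM2l // ler_pM2l ?exprn_gt0 // ler_pXn2r ?nnegrE ?enorm_ge0 //.
  by rewrite mulr_ge0 ?enorm_ge0 // ltW.
have h3 : alpha * dotv (grad F xk) (col i D) <=
    alpha * (- gamma0 * enorm (grad F xk) ^+ 2) by rewrite ler_pM2l.
move: h1 h2 h3; move: (dotv _ _) (enorm (grad F xk)) (dotv _ _) => u v w; lra.
Qed.

End MajorizeMinimize.

(** * Quantitative injectivity, and bounds on the coercive data term *)

Section CoerciveData.
Context {R : realType}.

(** The left inverse (C^T C)^-1 C^T is bounded by some K, so |v| <= K |C v|. *)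
Lemma injective_mulmx_lb m n (C : 'M[R]_(m, n)) :
  (forall u : 'cV[R]_n, C *m u = 0 -> u = 0) ->
  exists2 nu : R, 0 < nu & forall v, nu * enorm v ^+ 2 <= enorm (C *m v) ^+ 2.
Proof.
move=> injC; have UC := mulmx_trmxl_unit _ _ _ injC.
have [K K0 KP] := mulmx_enorm _ _ (invmx (C^T *m C) *m C^T).
exists (K ^+ 2)^-1; first by rewrite invr_gt0 exprn_gt0.
move=> v; rewrite mulrC ler_pdivrMr ?exprn_gt0 // mulrC -exprMn.
rewrite ler_pXn2r ?nnegrE ?enorm_ge0 ?mulr_ge0 ?enorm_ge0 ?(ltW K0) //.
by have := KP (C *m v); rewrite mulmxA -(mulmxA (invmx _)) mulVmx // mul1mx.
Qed.

Section Fidelity.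
Variables (Q : nat) (Phi : 'cV[R]_Q -> R) (L : R).
Hypothesis Phi_coercive : coercive Phi.
Hypothesis Phi_diff : forall z, differentiable Phi z.
Hypothesis Phi_lip :
  forall a b, enorm (grad Phi a - grad Phi b) <= L * enorm (a - b).

(* If L <= 0, then Phi lies below an affine function, hence is not coercive. *)
Lemma coercive_lipschitz_gt0 : (0 < Q)%N -> 0 < L.
Proof.
move=> Q0; rewrite ltNge; apply/negP => L0.
pose e : 'cV[R]_Q := delta_mx (Ordinal Q0) 0.
have e_gt0 : 0 < enorm e.
  apply: lt_le_trans (coord_enorm _ _ (Ordinal Q0)).
  by rewrite mxE !eqxx normr1.
pose g := grad Phi 0.
(* One of e and - e is a direction along which the affine bound does not increase. *)
have [h [h0 gh]] : exists h : 'cV[R]_Q, 0 < enorm h /\ dotv g h <= 0.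
  have [ge|/ltW ge] := leP (dotv g e) 0; first by exists e.
  by exists (- e); rewrite enormN dotvNr oppr_le0.
have [r rP] := Phi_coercive (Phi 0 + 1).
pose t := `|r| / enorm h.
have t0 : 0 <= t by rewrite divr_ge0 // ltW.
have := rP (t *: h); rewrite enormZ (ger0_norm t0) /t divfK ?gt_eqF // ler_norm.
move=> /(_ isT) h1.
have := lipschitz_gradient_ub _ Phi L Phi_diff Phi_lip 0 (t *: h).
rewrite add0r dotvZr => h2.
have h3 : t * dotv g h <= 0 by rewrite mulr_ge0_le0.
have h4 : L / 2 * enorm (t *: h) ^+ 2 <= 0.
  by rewrite mulr_le0_ge0 ?sqr_ge0 // mulr_le0_ge0.
move: h1 h2 h3 h4; rewrite -/t -/g.
move: (t * dotv g h) (L / 2 * enorm (t *: h) ^+ 2) (Phi (t *: h)) (Phi 0).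
by move=> *; lra.
Qed.

(** Outside a ball coercivity gives Phi >= 0. Inside, the descent lemma from z to 0 bounds Phi z
    below by Phi 0 minus terms controlled by |grad Phi z| <= G + L |z|. *)
Lemma coercive_lipschitz_lb : 0 < L -> exists m, forall z, m <= Phi z.
Proof.
move=> L0; have [r rP] := Phi_coercive 0.
pose G := enorm (grad Phi 0).
pose B := (G + L * `|r|) * `|r| + L / 2 * `|r| ^+ 2.
exists (- `|Phi 0| - B) => z.
have G0 : 0 <= G by exact: enorm_ge0.
have B0 : 0 <= B.
  by rewrite !(addr_ge0, mulr_ge0) ?sqr_ge0 // ltW.
have [rz|zr] := leP r (enorm z).
  by apply: le_trans (rP z rz); rewrite subr_le0 (le_trans _ B0) // oppr_le0.
have := lipschitz_gradient_ub _ Phi L Phi_diff Phi_lip z (- z).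
rewrite subrr enormN dotvNr.
have := dotv_norm_le (grad Phi z) z; rewrite ler_norml => /andP[h1 _].
have gz : enorm (grad Phi z) <= G + L * enorm z.
  rewrite -(subrK (grad Phi 0) (grad Phi z)) addrC.
  apply: (le_trans (enormD _ _)).
  by rewrite lerD2l; have := Phi_lip z 0; rewrite subr0.
have zr' : enorm z <= `|r| by apply: ltW; apply: lt_le_trans zr (ler_norm _).
have z0 := enorm_ge0 z.
move: (grad Phi z) h1 gz => gr h1 gz.
have h2 : enorm gr * enorm z <= (G + L * `|r|) * `|r|.
  apply: ler_pM => //; first exact: enorm_ge0.
  by apply: (le_trans gz); rewrite lerD2l ler_pM2l.
have h3 : L / 2 * enorm z ^+ 2 <= L / 2 * `|r| ^+ 2.
  by rewrite ler_wpM2l ?divr_ge0 ?(ltW L0) // ler_pXn2r ?nnegrE.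
have := ler_norm (- Phi 0); rewrite normrN /B.
move: h1 h2 h3; move: ((G + L * `|r|) * `|r|) (L / 2 * `|r| ^+ 2) => b1 b2.
move: (enorm gr * enorm z) (L / 2 * enorm z ^+ 2) => b3 b4.
by move: (dotv _ _) (Phi 0) (Phi z) => *; lra.
Qed.

End Fidelity.
End CoerciveData.

(** * The criterion: gradient, quadratic majorant, spectral bounds and sublevel sets *)

Section Criterion.
Context {R : realType}.
Variables (N Q S P0 : nat).
Variables (H : 'M[R]_(Q, N)) (y : 'cV[R]_Q) (V0 : 'M[R]_(P0, N)).
Variables (P : 'I_S -> nat) (V : forall s : 'I_S, 'M[R]_(P s, N)).
Variable c : forall s : 'I_S, 'cV[R]_(P s).
Variables (Phi : 'cV[R]_Q -> R) (psi : 'I_S -> R -> R).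
Variables (mu : R) (om : 'I_S -> R).
Hypothesis mu0 : 0 < mu.
Hypothesis Phi_coercive : coercive Phi.
Hypothesis Phi_diff : forall z, differentiable Phi z.
Hypothesis Phi_lip :
  forall a b, enorm (grad Phi a - grad Phi b) <= mu * enorm (a - b).
Hypothesis psi_ge0 : forall s t, 0 <= psi s t.
Hypothesis psi_derivable : forall s t, derivable (psi s) t 1.
Hypothesis psi_concave :
  forall s, concave_on_nonneg (fun t => psi s (Num.sqrt t)).
Hypothesis psi_deriv_bound :
  forall s t, 0 < t -> 0 <= derive1 (psi s) t <= om s * t.
Hypothesis psi_deriv_cvg :
  forall s, cvg ((fun t => derive1 (psi s) t / t) @ 0^'+).
Hypothesis ker_HV0 : forall v : 'cV[R]_N, H *m v = 0 -> V0 *m v = 0 -> v = 0.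

Local Notation F := (Fdelta H y V0 V c Phi psi).
Local Notation A := (Amat mu H V0 V c psi).
Local Notation w s x := (omega (psi s) (enorm (V s *m x - c s))).

Lemma gradient_at_Fdelta x : gradient_at F x
  (H^T *m grad Phi (H *m x - y) + \sum_s (V s)^T *m (w s x *: (V s *m x - c s))
   + V0^T *m (2 *: (V0 *m x))).
Proof.
apply: gradient_atD; last first.
  rewrite (_ : (fun _ => _) = fun z => enorm (V0 *m z - 0) ^+ 2); last first.
    by apply/funext => z; rewrite subr0.
  rewrite -[in X in gradient_at _ _ X](subr0 (V0 *m x)).
  exact: (gradient_at_mulmx _ _ (fun z => enorm z ^+ 2) V0 0 x _
    (gradient_at_sqr _ _)).
apply: gradient_atD.
  exact: (gradient_at_mulmx _ _ _ _ _ _ _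
    (gradient_at_grad _ _ _ (Phi_diff _))).
apply: gradient_at_sum => s.
apply: (gradient_at_mulmx _ _ (fun z => psi s (enorm z))).
exact: (gradient_at_enorm _ (om s) (psi_derivable s) (psi_deriv_bound s)
  (psi_deriv_cvg s)).
Qed.

Lemma dotv_Amat x v : dotv v (A x *m v) =
  mu * enorm (H *m v) ^+ 2 + 2 * enorm (V0 *m v) ^+ 2 +
  \sum_s w s x * enorm (V s *m v) ^+ 2.
Proof.
rewrite /Amat !mulmxDl !dotvDr -!scalemxAl !dotvZr; congr (_ * _ + _ * _ + _).
- by rewrite -mulmxA dotv_mulmxr trmxK -enorm_sqr.
- by rewrite -mulmxA dotv_mulmxr trmxK -enorm_sqr.
rewrite mulmx_suml dotv_sumr; apply: eq_bigr => s _.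
by rewrite -scalemxAl dotvZr -mulmxA dotv_mulmxr trmxK -enorm_sqr.
Qed.

Lemma Amat_sym x : (A x)^T = A x.
Proof.
rewrite /Amat !raddfD /= !linearZ /= !trmx_mul !trmxK; congr (_ + _).
rewrite raddf_sum; apply: eq_bigr => s _.
by rewrite /= linearZ /= trmx_mul trmxK.
Qed.

Lemma omega_ge0 s x : 0 <= w s x.
Proof.
by have /andP[] := omega_bound _ _ (psi_deriv_bound s) (psi_deriv_cvg s) _
  (enorm_ge0 (V s *m x - c s)).
Qed.

(** Term by term: the descent lemma with constant mu for Phi, the tangent bound in the squared norm
    for each penalty, and an exact expansion for the term in V0. The second-order parts add up to
    half the quadratic form of A. *)
Lemma Fdelta_majorant x h :
  F (x + h) <= F x + dotv (grad F x) h + dotv h (A x *m h) / 2.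
Proof.
rewrite (grad_eq _ _ _ _ (gradient_at_Fdelta x)) dotv_Amat !dotvDl.
rewrite !dotv_mulmxl !trmxK dotv_suml /Fdelta.
have hP := lipschitz_gradient_ub _ Phi mu Phi_diff Phi_lip
  (H *m x - y) (H *m h).
have hS : \sum_(s < S) psi s (enorm (V s *m (x + h) - c s)) <=
    \sum_(s < S) psi s (enorm (V s *m x - c s)) +
    \sum_s dotv ((V s)^T *m (w s x *: (V s *m x - c s))) h +
    (\sum_s w s x * enorm (V s *m h) ^+ 2) / 2.
  rewrite mulr_suml -!big_split; apply: ler_sum => s _ /=.
  apply: le_trans (psi_majorant (psi s) (psi_derivable s) (psi_concave s)
    (psi_deriv_cvg s) _ _ (enorm_ge0 _) (enorm_ge0 (V s *m x - c s))) _.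
  have -> : V s *m (x + h) - c s = V s *m x - c s + V s *m h.
    by rewrite mulmxDr addrAC.
  rewrite (enorm_sqrD (V s *m x - c s)) dotv_mulmxl trmxK dotvZl.
  move: (w s x) (dotv _ _) (enorm (V s *m h)) (enorm (V s *m x - c s)).
  by move=> a b d e; move: (psi s e) => *; lra.
have hV : enorm (V0 *m (x + h)) ^+ 2 = enorm (V0 *m x) ^+ 2 +
    dotv (2 *: (V0 *m x)) (V0 *m h) + enorm (V0 *m h) ^+ 2.
  by rewrite mulmxDr enorm_sqrD dotvZl.
have -> : H *m (x + h) - y = H *m x - y + H *m h by rewrite mulmxDr addrAC.
rewrite hV; move: hP hS; rewrite dotvZl.
move: (\sum_(s < S) psi s (enorm (V s *m (x + h) - c s))) => t1.
move: (\sum_(s < S) psi s (enorm (V s *m x - c s))) (\sum_s dotv _ h) => t2 t3.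
move: (\sum_s w s x * enorm (V s *m h) ^+ 2) => t4.
move: (Phi (H *m x - y + H *m h)) (Phi (H *m x - y)) => t5 t6.
move: (dotv (grad _ _) _) (dotv (V0 *m x) _) => t7 t8.
by move=> *; lra.
Qed.

(** The kernel condition says that the stacked matrix [col_mx H V0] is injective. *)
Lemma HV0_lb : exists2 nu : R, 0 < nu & forall v,
  nu * enorm v ^+ 2 <= enorm (H *m v) ^+ 2 + enorm (V0 *m v) ^+ 2.
Proof.
have [u|nu nu0 nuP] := injective_mulmx_lb _ _ (col_mx H V0).
  rewrite mul_col_mx => /eqP; rewrite col_mx_eq0 => /andP[/eqP u1 /eqP u2].
  exact: ker_HV0.
exists nu => // v; apply: (le_trans (nuP v)).
rewrite !enorm_sqr mul_col_mx !dotvE tr_col_mx mul_row_col mxE.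
exact: lexx.
Qed.

Lemma Amat_lb : exists2 nu : R, 0 < nu & forall x v,
  nu * enorm v ^+ 2 <= dotv v (A x *m v).
Proof.
have [nu nu0 nuP] := HV0_lb; pose m := Num.min mu 2.
have m0 : 0 < m by rewrite lt_min mu0 /=.
exists (m * nu) => [|x v]; first by rewrite mulr_gt0.
rewrite dotv_Amat -mulrA; apply: (@le_trans _ _
  (mu * enorm (H *m v) ^+ 2 + 2 * enorm (V0 *m v) ^+ 2)); last first.
  by rewrite lerDl sumr_ge0 // => s _; rewrite mulr_ge0 ?sqr_ge0 ?omega_ge0.
apply: (@le_trans _ _ (m * (enorm (H *m v) ^+ 2 + enorm (V0 *m v) ^+ 2))).
  by rewrite ler_pM2l.
rewrite mulrDr lerD // ler_wpM2r ?sqr_ge0 // ge_min lexx ?orbT //.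
Qed.

(** The bound is uniform in x because each weight is at most [om s]. *)
Lemma Amat_ub : exists2 eta : R, 0 < eta & forall x v,
  dotv v (A x *m v) <= eta * enorm v ^+ 2.
Proof.
have sq m (B : 'M[R]_(m, N)) : exists2 C : R, 0 < C &
    forall v, enorm (B *m v) ^+ 2 <= C * enorm v ^+ 2.
  have [C C0 CP] := mulmx_enorm _ _ B; exists (C ^+ 2); first exact: exprn_gt0.
  move=> v; rewrite -exprMn ler_pXn2r ?nnegrE ?enorm_ge0 //.
  by rewrite mulr_ge0 ?enorm_ge0 // ltW.
have [CH CH0 CHP] := sq _ H; have [C0 C00 C0P] := sq _ V0.
have /choice [C CP] : forall s, exists C : R, forall v x,
    w s x * enorm (V s *m v) ^+ 2 <= C * enorm v ^+ 2.
  move=> s; have [C Cp CP] := sq _ (V s); exists (om s * C) => v x.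
  have /andP[w0 w1] := omega_bound _ _ (psi_deriv_bound s) (psi_deriv_cvg s) _
    (enorm_ge0 (V s *m x - c s)).
  by rewrite -mulrA ler_pM ?sqr_ge0.
pose T := mu * CH + 2 * C0 + \sum_s C s.
exists (`|T| + 1) => [|x v]; first by rewrite ltr_wpDl.
apply: (@le_trans _ _ (T * enorm v ^+ 2)); last first.
  by rewrite ler_wpM2r ?sqr_ge0 // (le_trans (ler_norm _)) // lerDl.
have -> : T * enorm v ^+ 2 = mu * (CH * enorm v ^+ 2) +
    2 * (C0 * enorm v ^+ 2) + (\sum_s C s) * enorm v ^+ 2 by rewrite /T; ring.
rewrite dotv_Amat mulr_suml; apply: lerD; last exact: ler_sum.
by apply: lerD; rewrite ler_pM2l.
Qed.

(** Coercivity of Phi bounds H z, the lower bound m of Phi bounds V0 z, and together they bound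
    z. *)
Lemma Fdelta_sublevel_bounded C : exists r, forall z, F z <= C -> enorm z <= r.
Proof.
have [m mP] := coercive_lipschitz_lb _ Phi mu Phi_coercive Phi_diff Phi_lip mu0.
have [nu nu0 nuP] := HV0_lb.
have [r rP] := Phi_coercive (C + 1).
pose T := (`|r| + enorm y) ^+ 2 + `|C - m|.
(* From |z|^2 <= t follows |z| <= t + 1, which avoids a square root. *)
exists (T / nu + 1) => z Fz.
have psum : 0 <= \sum_(s < S) psi s (enorm (V s *m z - c s)).
  by apply: sumr_ge0 => s _; exact: psi_ge0.
have V0z := sqr_ge0 (enorm (V0 *m z)).
move: Fz; rewrite /Fdelta => Fz.
have hr : enorm (H *m z - y) <= `|r|.
  apply: le_trans (ler_norm r); rewrite leNgt; apply/negP => /ltW /rP.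
  move: Fz psum V0z; move: (Phi _) (\sum_s _) (_ ^+ 2) => *; lra.
have hH : enorm (H *m z) <= `|r| + enorm y.
  rewrite -(subrK y (H *m z)); apply: (le_trans (enormD _ _)).
  by rewrite lerD2r.
have hH2 : enorm (H *m z) ^+ 2 <= (`|r| + enorm y) ^+ 2.
  by rewrite ler_pXn2r ?nnegrE ?addr_ge0 ?enorm_ge0.
have hV : enorm (V0 *m z) ^+ 2 <= `|C - m|.
  apply: le_trans (ler_norm _); move: Fz psum (mP (H *m z - y)).
  by move: (Phi _) (\sum_s _) (_ ^+ 2) => *; lra.
have : enorm z ^+ 2 <= T / nu.
  rewrite ler_pdivlMr // mulrC; apply: (le_trans (nuP z)); exact: lerD.
by move: (enorm z) (T / nu) => u t h; have := sqr_ge0 (u - 1); nra.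
Qed.

End Criterion.

(** * Convergence of the subspace iteration *)

Theorem theorem3 (R : realType) (N Q S M J P0 : nat)
  (hN : (1 <= N)%N) (hQ : (1 <= Q)%N) (hS : (1 <= S)%N)
  (hM : (0 < M)%N) (hMN : (M <= N)%N) (hJ : (1 <= J)%N)
  (H : 'M[R]_(Q, N)) (y : 'cV[R]_Q) (V0 : 'M[R]_(P0, N))
  (P : 'I_S -> nat) (V : forall s : 'I_S, 'M[R]_(P s, N))
  (c : forall s : 'I_S, 'cV[R]_(P s))
  (Phi : 'cV[R]_Q -> R) (psi : 'I_S -> R -> R -> R)
  (delta L mu : R) (D : nat -> 'M[R]_(N, M)) (x : nat -> 'cV[R]_N) :
  H != 0 ->
  (forall s, (1 <= P s)%N) ->
  (* (A1) *)
  continuous Phi -> coercive Phi ->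
  (forall (d : R) (s : 'I_S), 0 < d ->
     continuous (psi s d) /\ forall t, 0 <= psi s d t) ->
  (forall v : 'cV[R]_N, H *m v = 0 -> V0 *m v = 0 -> v = 0) ->
  (* (A3) for the fixed delta *)
  0 < delta ->
  (forall z, differentiable Phi z) ->
  (forall a b, enorm (grad Phi a - grad Phi b) <= L * enorm (a - b)) ->
  (forall s t, derivable (psi s delta) t 1) ->
  (forall s, concave_on_nonneg (fun t => psi s delta (Num.sqrt t))) ->
  (forall s, exists om : R, 0 <= om /\
     forall t, 0 < t -> 0 <= derive1 (psi s delta) t <= om * t) ->
  (forall s, cvg ((fun t => derive1 (psi s delta) t / t) @ 0^'+)) ->
  KL_ineq (Fdelta H y V0 V c Phi (fun s => psi s delta)) ->
  (* algorithm *)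
  L <= mu ->
  (forall k, x k.+1 = mm_step J
       (Amat mu H V0 V c (fun s => psi s delta))
       (grad (Fdelta H y V0 V c Phi (fun s => psi s delta))) (x k) (D k)) ->
  (* (A4) *)
  (exists gamma0 gamma1 : R, 0 < gamma0 /\ 0 < gamma1 /\
     forall k,
       let g := grad (Fdelta H y V0 V c Phi (fun s => psi s delta)) (x k) in
       let d1 := col (Ordinal hM) (D k) in
       dotv g d1 <= - gamma0 * enorm g ^+ 2 /\ enorm d1 <= gamma1 * enorm g) ->
  exists xt : 'cV[R]_N,
    x k @[k --> \oo] --> xt /\
    grad (Fdelta H y V0 V c Phi (fun s => psi s delta)) xt = 0 /\
    (\sum_(0 <= k <oo) (enorm (x k.+1 - x k))%:E < +oo)%E.
Proof.
move=> _ _ _ Phi_co psi_A1 ker delta0 Phi_diff Phi_lipL psi_der psi_conc psi_om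
  psi_cvg KL Lmu xS [gamma0 [gamma1 [g0 [g1 xD]]]].
pose psid s := psi s delta.
(* Positivity of mu is inherited from L, which is positive by coercivity of Phi. *)
have mu0 : 0 < mu.
  by apply: lt_le_trans Lmu; exact: (coercive_lipschitz_gt0 _ Phi L).
have Phi_lip a b : enorm (grad Phi a - grad Phi b) <= mu * enorm (a - b).
  by apply: (le_trans (Phi_lipL a b)); rewrite ler_wpM2r ?enorm_ge0.
have [om om_bound] := choice psi_om.
have om_deriv s t : 0 < t -> 0 <= derive1 (psid s) t <= om s * t.
  by have [_] := om_bound s; exact.
have psi_ge0 s t : 0 <= psid s t by have [_] := psi_A1 delta s delta0; exact.
set F := Fdelta H y V0 V c Phi psid in KL xS xD *.
have gradF z : gradient_at F z (grad F z).
  have Fz := gradient_at_Fdelta _ _ _ _ H y V0 P V c Phi psid om Phi_diff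
    psi_der om_deriv psi_cvg z.
  by rewrite (grad_eq _ _ _ _ Fz).
have Fmaj := Fdelta_majorant _ _ _ _ H y V0 P V c Phi psid mu om Phi_diff
  Phi_lip psi_der psi_conc om_deriv psi_cvg.
have Asym := Amat_sym _ _ _ _ H V0 P V c psid mu.
have [nu nu0 Alb] := Amat_lb _ _ _ _ H V0 P V c psid mu om mu0 om_deriv
  psi_cvg ker.
have [eta eta0 Aub] := Amat_ub _ _ _ _ H V0 P V c psid mu om mu0 om_deriv
  psi_cvg.
set A := Amat mu H V0 V c psid in xS Asym Alb Aub Fmaj.
have [a a0 stepP] := mm_step_decrease _ F A nu nu0 Asym Alb Fmaj J.
have [b b0 gradP] := mm_step_gradient _ F A nu eta nu0 eta0 Asym Alb Aub Fmaj
  J gamma0 gamma1 hJ g0 g1.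
have step k : a * enorm (x k.+1 - x k) ^+ 2 <= F (x k) - F (x k.+1).
  by rewrite xS; exact: stepP.
have gstep k : b * enorm (grad F (x k)) ^+ 2 <= F (x k) - F (x k.+1).
  by rewrite xS; have [h1 h2] := xD k; exact: gradP h1 h2.
have [r rP] := Fdelta_sublevel_bounded _ _ _ _ H y V0 P V c Phi psid mu mu0
  Phi_co Phi_diff Phi_lip psi_ge0 ker (F (x 0%N)).
have xr k : enorm (x k) <= r.
  by apply: rP; exact: (F_noninc _ F x a a0 step 0%N k).
have Fub z h : F (z + h) <= F z + dotv (grad F z) h + eta / 2 * enorm h ^+ 2.
  apply: (le_trans (Fmaj z h)); rewrite lerD2l mulrAC ler_pM2r ?invr_gt0 //.
exact: (descent_cvg _ F x a b (eta / 2) r a0 b0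
  (divr_ge0 (ltW eta0) (ler0n R 2)) gradF Fub step gstep xr KL).
Qed.
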